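(* Let $m\ge1$, $q,q_1,\dots,q_m\in[1,\infty)$ and $\alpha,\alpha_1,\dots,\alpha_m\in\mathbb R$ with $\alpha_i>-n$, such that $\sum_{i=1}^m\frac1{q_i}=\frac1q$ and $\sum_{i=1}^m\frac{\alpha_i}{q_i}=\frac{\alpha}{q}$. Let $\omega_i(x)=|x|_p^{\alpha_i}$, $\omega(x)=|x|_p^{\alpha}$, and assume condition (DK1). Let $\lambda_i\in(-\frac1{q_i},0)$ for $i=1,\dots,m$ and let $\lambda\in\mathbb R$ satisfy $$(\alpha+n)\lambda=(\alpha_1+n)\lambda_1+\cdots+(\alpha_m+n)\lambda_m.$$ Then $\mathcal H^p_{\Phi,\vec A}$ is bounded from $\dot B^{q_1,\lambda_1}_{\omega_1}(\mathbb Q_p^n)\times\cdots\times\dot B^{q_m,\lambda_m}_{\omega_m}(\mathbb Q_p^n)$ to $\dot B^{q,\lambda}_\omega(\mathbb Q_p^n)$ if and only if $$\mathcal C_3=\int_{\mathbb Q_p^n}\frac{\Phi(y)}{|y|_p^n}\prod_{i=1}^m\|A_i^{-1}(y)\|_p^{-(\alpha_i+n)\lambda_i}\,dy<\infty.$$ Moreover, the operator norm is comparable to $\mathcal C_3$ (bounded above and below by constant multiples of $\mathcal C_3$).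
   Context: Let $p$ be a prime, $\mathbb Q_p$ the $p$-adic numbers with absolute value $|\cdot|_p$; for $x\in\mathbb Q_p^n$, $|x|_p=\max_j|x_j|_p$. $dx$ is the Haar measure on $\mathbb Q_p^n$ normalized so that $B_0$ has measure 1, where $B_\gamma=\{x:|x|_p\le p^\gamma\}$, $\gamma\in\mathbb Z$. For an $n\times n$ matrix $A=(a_{ij})$ over $\mathbb Q_p$, $\|A\|_p=\max_{i,j}|a_{ij}|_p$. For a weight $\omega$, $\omega(E)=\int_E\omega$ and $\|f\|_{L^q_\omega(E)}=(\int_E|f|^q\omega)^{1/q}$. Weighted central Morrey space: for $\lambda\in\mathbb R$, $1\le q<\infty$, $\dot B^{q,\lambda}_\omega(\mathbb Q_p^n)$ is the set of $f$ locally in $L^q_\omega$ with $\|f\|_{\dot B^{q,\lambda}_\omega}=\sup_{\gamma\in\mathbb Z}\big(\omega(B_\gamma)^{-1-\lambda q}\int_{B_\gamma}|f|^q\omega\,dx\big)^{1/q}<\infty$. Let $\Phi:\mathbb Q_p^n\to[0,\infty)$ be measurable and $A_1(y),\dots,A_m(y)$ $n\times n$ matrices over $\mathbb Q_p$, measurable in $y$, invertible for a.e. $y$. $\mathcal H^p_{\Phi,\vec A}(\vec f)(x)=\int_{\mathbb Q_p^n}\frac{\Phi(y)}{|y|_p^n}\prod_{i=1}^m f_i(A_i(y)x)\,dy$. Condition (DK1): there is $\nu\in\mathbb N$ with $\|A_i(y)\|_p\|A_i^{-1}(y)\|_p\le p^\nu$ for all $i$ and a.e. $y$. *)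

(* Defs.v *)
From HB Require Import structures.
From mathcomp Require Import all_boot all_order all_algebra.
From mathcomp Require Import all_classical all_reals all_analysis.
Import Order.TTheory GRing.Theory Num.Theory.



Unset Printing Implicit Defensive.

Local Open Scope classical_set_scope.
Local Open Scope ring_scope.


(* Q_p^n as column vectors; the alias is made pointed (by 0) so that the
   generated sigma-algebra type is available. *)
Definition pvec (K : fieldType) (n : nat) := 'cV[K]_n.
HB.instance Definition _ (K : fieldType) (n : nat) :=
  Choice.copy (pvec K n) 'cV[K]_n.
HB.instance Definition _ (K : fieldType) (n : nat) :=
  isPointed.Build (pvec K n) (0%R : 'cV[K]_n).

Section Padic.
Context {R : realType}.

Definition padic_abs_rat (p : nat) (r : rat) : R :=
  if r == 0 then 0
  else (p%:R : R) ^ (- ((logn p `|numq r|%N)%:Z - (logn p `|denq r|%N)%:Z)).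

(* (K, abs) is (a model of) the field Q_p of p-adic numbers with its
   absolute value |.|_p : a complete non-archimedean valued field in which
   the rationals are dense and carry the p-adic absolute value.  This
   characterizes (Q_p, |.|_p) up to isometric field isomorphism. *)
Definition is_Qp_model (p : nat) {K : fieldType} (abs : K -> R) : Prop :=
  (forall x, 0 <= abs x) /\
  (forall x, abs x = 0 <-> x = 0) /\
  (forall x y, abs (x * y) = abs x * abs y) /\
  (forall x y, abs (x + y) <= Num.max (abs x) (abs y)) /\
  (forall r : rat, abs (ratr r) = padic_abs_rat p r) /\
  (forall (x : K) (e : R), 0 < e -> exists r : rat, abs (x - ratr r) < e) /\
  (forall u : nat -> K,
        (forall e : R, 0 < e -> exists N : nat, forall k l : nat,
            (N <= k)%N -> (N <= l)%N -> abs (u k - u l) < e) ->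
        exists L : K, forall e : R, 0 < e -> exists N : nat, forall k : nat,
            (N <= k)%N -> abs (u k - L) < e).

Context {K : fieldType} (abs : K -> R).

Definition vnorm {n : nat} (x : 'cV[K]_n) : R :=
  \big[Num.max/0]_(i < n) abs (x i ord0).

Definition mnorm {n : nat} (A : 'M[K]_n) : R :=
  \big[Num.max/0]_(i < n) \big[Num.max/0]_(j < n) abs (A i j).

(* closed balls {y : |y - a|_p <= p^g}, a in Q_p^n, g in Z; they generate
   the Borel sigma-algebra of Q_p^n (separable ultrametric space). *)
Definition padic_balls (p n : nat) : set (set (pvec K n)) :=
  fun S => exists (a : 'cV[K]_n) (g : int),
    S = [set y : pvec K n | vnorm ((y : 'cV[K]_n) - a) <= (p%:R : R) ^ g].

Local Notation Qpn p n := (g_sigma_algebraType (padic_balls p n)).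

Definition Bball (p n : nat) (g : int) : set (Qpn p n) :=
  [set x | vnorm (x : 'cV[K]_n) <= (p%:R : R) ^ g].

Definition is_haar (p n : nat) (mu : {measure set (Qpn p n) -> \bar R}) : Prop :=
  (forall (a : 'cV[K]_n) (E : set (Qpn p n)), measurable E ->
     mu ([set (a + (x : 'cV[K]_n)) | x in E] : set (Qpn p n)) = mu E)
  /\ mu (Bball p n 0) = 1%E.

Definition wpow {n : nat} (alpha : R) (x : 'cV[K]_n) : R := (vnorm x) `^ alpha.

Section Morrey.
Context {p n : nat} (mu : {measure set (Qpn p n) -> \bar R}).

Definition wball (alpha : R) (g : int) : \bar R :=
  (\int[mu]_(x in Bball p n g) (wpow alpha x)%:E)%E.

Definition morrey_norm (q lam alpha : R) (F : Qpn p n -> \bar R) : \bar R :=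
  ereal_sup (range (fun g : int =>
    (((fine (wball alpha g)) `^ (- 1 - lam * q))%:E *
      \int[mu]_(x in Bball p n g) ((`|F x| `^ q) * (wpow alpha x)%:E))
     `^ q^-1))%E.

Definition in_morrey (q lam alpha : R) (f : Qpn p n -> R) : Prop :=
  [/\ measurable_fun setT f,
      (forall g : int,
         \int[mu]_(x in Bball p n g) ((`|f x| `^ q * wpow alpha x)%:E) < +oo)%E
    & (morrey_norm q lam alpha (fun x => (f x)%:E) < +oo)%E].

Definition Hop (m : nat) (Phi : Qpn p n -> R) (A : 'I_m -> Qpn p n -> 'M[K]_n)
    (fs : 'I_m -> Qpn p n -> R) (x : Qpn p n) : \bar R :=
  (\int[mu]_y ((Phi y / (vnorm (y : 'cV[K]_n) ^+ n)) *
     \prod_(i < m) fs i (A i y *m (x : 'cV[K]_n)))%:E)%E.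

Definition Hbound (m : nat) (Phi : Qpn p n -> R) (A : 'I_m -> Qpn p n -> 'M[K]_n)
    (q lam alpha : R) (qs lams alphas : 'I_m -> R) (C : R) : Prop :=
  forall fs : 'I_m -> Qpn p n -> R,
    (forall i, in_morrey (qs i) (lams i) (alphas i) (fs i)) ->
    (morrey_norm q lam alpha (Hop m Phi A fs) <=
      (C * \prod_(i < m) fine (morrey_norm (qs i) (lams i) (alphas i)
                                 (fun x => (fs i x)%:E)))%:E)%E.

Definition Hbounded m Phi A q lam alpha qs lams alphas : Prop :=
  exists C : R, @Hbound m Phi A q lam alpha qs lams alphas C.

(* operator norm (infimum of admissible constants; +oo if unbounded) *)
Definition Hopnorm m Phi A q lam alpha qs lams alphas : \bar R :=
  ereal_inf [set C%:E | C in [set C : R | 0 <= C /\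
                 @Hbound m Phi A q lam alpha qs lams alphas C]].

Definition C3 (m : nat) (Phi : Qpn p n -> R) (A : 'I_m -> Qpn p n -> 'M[K]_n)
    (alphas lams : 'I_m -> R) : \bar R :=
  (\int[mu]_y ((Phi y / (vnorm (y : 'cV[K]_n) ^+ n)) *
     \prod_(i < m) (mnorm (invmx (A i y))) `^ (- ((alphas i + n%:R) * lams i)))%:E)%E.

End Morrey.

Definition meas_mx (p n : nat) (A : Qpn p n -> 'M[K]_n) : Prop :=
  forall (j k : 'I_n) (a : K) (r : R),
    measurable [set y : Qpn p n | abs (A y j k - a) <= r].

End Padic.

Arguments wball {R K abs p n} mu alpha g.
Arguments morrey_norm {R K abs p n} mu q lam alpha F.
Arguments in_morrey {R K abs p n} mu q lam alpha f.
Arguments Hop {R K abs p n} mu m Phi A fs x.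
Arguments Hbound {R K abs p n} mu {m} Phi A q lam alpha qs lams alphas C.
Arguments Hbounded {R K abs p n} mu {m} Phi A q lam alpha qs lams alphas.
Arguments Hopnorm {R K abs p n} mu {m} Phi A q lam alpha qs lams alphas.
Arguments C3 {R K abs p n} mu {m} Phi A alphas lams.
Arguments meas_mx {R K} abs {p n} A.
Arguments is_haar {R K} abs {p n} mu.

Notation Qpn abs p n := (@g_sigma_algebraType _ (@padic_balls _ _ abs p n)).

(* Main.v *)
(** Under (DK1) each [A_i(y)] distorts norms by [|A_i^-1(y)|^-1] up to the fixed
    factor [p^nu].

    Necessity: for [beta_i = (alpha_i + n) lambda_i < 0] the functions
    [f_i(x) = |x|^beta_i] have finite norms, and the operator maps them to a function
    that is at least a constant times [C_3 |x|^((alpha + n) lambda)].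

    Sufficiency: the change of variables [z = A_i(y) x] has a Jacobian of at most
    [|A_i^-1(y)|^n], so the dilates [f_i(A_i(y) x)], multiplied by
    [|A_i^-1(y)|^beta_i], have [L^{q_i}] norms on balls that are bounded
    independently of [y].  Hoelder's inequality in [x] and Jensen's inequality for
    the measure [Phi(y) |y|^-n prod_i |A_i^-1(y)|^(- beta_i) dy], whose mass is
    [C_3], conclude.

    The Haar measure is handled through the fact that a ball is a disjoint union of
    [p^n] translates of the next smaller one: this determines a translation-invariant
    measure on all balls, hence everywhere, and so its behaviour under linear maps. *)
Require Import Defs.
From HB Require Import structures.
From mathcomp Require Import all_boot all_order all_algebra.
From mathcomp Require Import all_classical all_reals all_analysis.
From mathcomp Require Import measurable_realfun ring.
Set Implicit Arguments.
Unset Strict Implicit.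
Import Order.TTheory GRing.Theory Num.Theory numFieldNormedType.Exports.
Local Open Scope classical_set_scope.
Local Open Scope ring_scope.

(** * The p-adic absolute value and the norms of vectors and matrices *)

Section valued_field.
Context {p : nat} {R : realType} {K : fieldType} {abs : K -> R}.
Context (hp : prime p) (hK : is_Qp_model p abs).

Local Notation P := (p%:R : R).

(** The field is known only through its axioms, and the density of the rationals does most of the
    work: it yields the value group, the base-[p] digits that split a ball, and the countable
    families of balls behind measurability. [C3] may be infinite, so the lower estimate carries an
    extended-real coefficient; finiteness of [C3] and the bound on the operator norm then come out
    of one inequality. In the upper estimate, the obstacle is that the norm of an integral over [y]
    is wanted while only bounds for each fixed [y] are available. Jensen moves the power [q] under
    the integral, after which Tonelli lets the integral over [x] be done first. Hoelder for [m]
    factors is a pointwise AM-GM inequality whose normalizing levels depend on neither [x] nor [y],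
    and integrating it gives the product of the levels. A dilation turns [B g] into a subset of a
    ball enlarged by the factor [|A|], whereas the Jacobian and the weight produce powers of the
    norm of the inverse; (DK1) lets these cancel up to powers of [p^nu]. The constants thus involve
    only [p], [n], [nu], the exponents and masses of the unit ball, and can be fixed before [Phi]
    and [A]. *)

Lemma Qp_base_gt1 : 1 < P.
Proof. by rewrite ltr1n prime_gt1. Qed.
Lemma Qp_base_gt0 : 0 < P. Proof. exact: lt_trans Qp_base_gt1. Qed.
Local Notation P1 := Qp_base_gt1.
Local Notation P0 := Qp_base_gt0.

Lemma abs_ge0 x : 0 <= abs x. Proof. by case: hK. Qed.
Lemma abs_eq0 x : (abs x == 0) = (x == 0).
Proof. case: hK => _ [+ _] => /(_ x) h; apply/eqP/eqP => h'; exact/h. Qed.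
Lemma abs0 : abs 0 = 0. Proof. by apply/eqP; rewrite abs_eq0. Qed.
Lemma absM : {morph abs : x y / x * y}. Proof. by case: hK => _ [_ [+ _]]. Qed.
Lemma absD x y : abs (x + y) <= Num.max (abs x) (abs y).
Proof. by case: hK => _ [_ [_ [+ _]]]. Qed.
Lemma abs1 : abs 1 = 1.
Proof.
have h : abs 1 != 0 by rewrite abs_eq0 oner_eq0.
by apply: (mulfI h); rewrite -absM !mulr1.
Qed.
Lemma absN x : abs (- x) = abs x.
Proof.
have : abs (-1) ^+ 2 = 1 by rewrite expr2 -absM mulrNN mulr1 abs1.
move/eqP; rewrite sqrf_eq1 => /orP[] /eqP h; first by rewrite -mulN1r absM h mul1r.
by have := abs_ge0 (-1); rewrite h ler0N1.
Qed.
Lemma absB x y : abs (x - y) <= Num.max (abs x) (abs y).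
Proof. by rewrite -(absN y); exact: absD. Qed.
Lemma absV x : abs x^-1 = (abs x)^-1.
Proof.
have [->|x0] := eqVneq x 0; first by rewrite invr0 abs0 invr0.
have h : abs x != 0 by rewrite abs_eq0.
by apply: (mulfI h); rewrite -absM !divff // abs1.
Qed.
Lemma absX x k : abs (x ^+ k) = abs x ^+ k.
Proof. by elim: k => [|k IH]; rewrite ?expr0 ?abs1 // !exprS absM IH. Qed.
Lemma abs_ratr r : abs (ratr r) = padic_abs_rat p r.
Proof. by case: hK => _ [_ [_ [_ [+ _]]]]. Qed.
Lemma ratr_dense x (e : R) : 0 < e -> exists r : rat, abs (x - ratr r) < e.
Proof. by case: hK => _ [_ [_ [_ [_ [+ _]]]]] => /(_ x e). Qed.

Lemma abs_intr (z : int) : z != 0 -> abs z%:~R = P ^- (logn p `|z|%N).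
Proof.
move=> z0; have <- : ratr (z%:~R) = z%:~R :> K by rewrite ratr_int.
rewrite abs_ratr /padic_abs_rat intr_eq0 (negbTE z0).
have -> : numq z%:~R = z by exact: numq_int.
have -> : denq z%:~R = 1 by exact: denq_int.
by rewrite logn1 subr0 exprnN.
Qed.

Lemma abs_p : abs p%:R = P^-1.
Proof.
have := @abs_intr p%:Z; rewrite /= -pmulrn => ->; last by rewrite -lt0n prime_gt0.
by rewrite lognE hp prime_gt0 // dvdnn divnn prime_gt0 // logn1 expr1.
Qed.

Lemma Qp_pX_neq0 (g : int) : (p%:R : K) ^ g != 0.
Proof. by apply: expfz_neq0; rewrite -abs_eq0 abs_p invr_eq0 gt_eqF ?P0. Qed.

Lemma abs_pX (g : int) : abs (p%:R ^ g) = P ^ (- g).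
Proof.
case: g => k; first by rewrite -exprnP absX abs_p -exprnN exprVn.
by rewrite NegzE opprK -exprnN absV absX abs_p exprVn invrK.
Qed.

Lemma abs_intr_le1 (z : int) : abs z%:~R <= 1.
Proof.
have [->|z0] := eqVneq z 0; first by rewrite abs0 ler01.
by rewrite abs_intr // invf_le1 ?exprn_gt0 ?P0 // exprn_ege1 // ltW // P1.
Qed.

Lemma abs_intr_dvdn (z : int) : (p %| `|z|)%N -> abs z%:~R <= P^-1.
Proof.
move=> /dvdnP[k zk].
have -> : z%:~R = (sgz z * k%:Z)%:~R * p%:R :> K.
  by rewrite (pmulrn 1 p) -intrM -mulrA -PoszM -zk -intEsg.
by rewrite absM abs_p ler_piMl ?abs_intr_le1 // invr_ge0 ltW // P0.
Qed.

Lemma abs_intr_eq1 (z : int) : ~~ (p %| `|z|)%N -> abs z%:~R = 1.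
Proof.
move=> pz; have z0 : z != 0 by apply: contra pz => /eqP ->; rewrite absz0 dvdn0.
by rewrite abs_intr // lognE (negbTE pz) !andbF invr1.
Qed.

Lemma dvdn_abs_intr_lt1 (z : int) : abs z%:~R < 1 -> (p %| `|z|)%N.
Proof. by apply: contraLR => /abs_intr_eq1 ->; rewrite ltxx. Qed.

(** In an ultrametric triangle the two longest sides are equal. This transfers values of [abs] from
    rationals to arbitrary elements. *)
Lemma abs_eq (x y : K) : abs (x - y) < abs x -> abs y = abs x.
Proof.
move=> h; apply/eqP; rewrite eq_le; apply/andP; split.
  have -> : y = x - (x - y) by rewrite opprB addrC subrK.
  by apply: (le_trans (absB _ _)); rewrite ge_max lexx ltW.
have := absD (x - y) y; rewrite subrK le_max => /orP[h'|//].
by have := lt_le_trans h h'; rewrite ltxx.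
Qed.

(** The digits [0, ..., p-1] represent all residues: a rational close to [x] is again integral, so
    [p] does not divide its reduced denominator, which can be inverted modulo [p]. *)
Lemma residue_exists (x : K) : abs x <= 1 ->
  exists i : 'I_p, abs (x - (i : nat)%:R) <= P^-1.
Proof.
move=> x1; have [r hr] := ratr_dense x (e := P^-1) ltac:(by rewrite invr_gt0 P0).
have Pi1 : P^-1 < 1 by rewrite invf_lt1 ?P0 ?P1.
have r1 : abs (ratr r) <= 1.
  have -> : ratr r = x - (x - ratr r) by rewrite opprB addrC subrK.
  apply: (le_trans (absB _ _)); rewrite ge_max x1 /=.
  by rewrite ltW // (lt_trans hr).
set a := numq r; set b := denq r.
have rE : ratr r = a%:~R / b%:~R :> K by [].
have b0 : b != 0 by rewrite denq_eq0.
have bK : (b%:~R : K) != 0.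
  by rewrite -abs_eq0 abs_intr // invr_eq0 expf_eq0 gt_eqF ?P0 // andbF.
have pb : ~~ (p %| `|b|)%N.
  apply/negP => pb; have pa : ~~ (p %| `|a|)%N.
    apply/negP => pa; have := coprime_num_den r; rewrite -/a -/b => /eqP h.
    have : (p %| 1)%N by rewrite -h dvdn_gcd pa pb.
    by rewrite dvdn1 => /eqP p1; have := prime_gt1 hp; rewrite p1.
  move: r1; rewrite rE absM absV (abs_intr_eq1 pa) mul1r.
  rewrite invf_le1 ?lt_def ?abs_ge0 ?abs_eq0 ?bK // => h.
  by have := le_lt_trans (le_trans h (abs_intr_dvdn pb)) Pi1; rewrite ltxx.
(* Bezout gives [u] with [u b = 1] modulo [p]; the digit of [a / b] is then [a u] modulo [p]. *)
have cop : coprimez b p%:Z by rewrite coprimezE coprime_sym prime_coprime.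
have /coprimezP[[u v] /= uv] := cop.
have pz0 : (p%:Z != 0) by rewrite -lt0n prime_gt0.
pose i := ((a * u) %% p%:Z)%Z.
have i0 : 0 <= i by rewrite modz_ge0.
have ip : i < p%:Z by rewrite ltz_pmod // ltz_nat prime_gt0.
have iE : i = `|i|%N :> int by rewrite gez0_abs.
have ipN : (`|i|%N < p)%N by rewrite -ltz_nat -iE.
exists (Ordinal ipN) => /=.
have -> : (`|i|%N%:R : K) = i%:~R by rewrite [in RHS]iE pmulrn.
have -> : x - i%:~R = (x - ratr r) + (ratr r - i%:~R) by rewrite addrA subrK.
apply: (le_trans (absD _ _)); rewrite ge_max (ltW hr) /=.
have -> : ratr r - i%:~R = (a - i * b)%:~R / b%:~R :> K.
  by rewrite rE intrD intrN intrM mulrBl mulfK.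
rewrite absM absV (abs_intr_eq1 pb) invr1 mulr1.
apply: abs_intr_dvdn; change (p%:Z %| (a - i * b)%R)%Z.
rewrite -eqz_mod_dvd /i modzMml.
have -> : a * u * b = a - (a * v) * p%:Z.
  by rewrite -{2}(mulr1 a) -uv mulrDr !mulrA addrK.
by rewrite eqz_mod_dvd opprB addrCA subrr addr0 dvdz_mull.
Qed.

Lemma residue_unique (i j : nat) : (i < p)%N -> (j < p)%N ->
  abs (i%:R - j%:R) < 1 -> i = j.
Proof.
move=> ip jp; have -> : (i%:R - j%:R : K) = (i%:Z - j%:Z)%:~R.
  by rewrite intrB !pmulrn.
move=> /dvdn_abs_intr_lt1; change ((p%:Z %| (i%:Z - j%:Z)%R)%Z -> i = j).
by rewrite -eqz_mod_dvd !modz_nat => /eqP[]; rewrite !modn_small.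
Qed.

(** A rational closer to [x] than [abs x] has the same absolute value, which is an integer power of
    [p] by the model axiom. *)
Lemma abs_valueP (x : K) : x != 0 -> exists g : int, abs x = P ^ g.
Proof.
move=> x0; have ax : 0 < abs x by rewrite lt_def abs_ge0 abs_eq0 x0.
have [r hr] := ratr_dense x ax.
rewrite -(abs_eq hr) abs_ratr /padic_abs_rat; case: eqVneq => [r0|_]; last by eexists.
by move: hr; rewrite r0 (ratr_int _ 0) subr0 ltxx.
Qed.

Lemma abs_sum_le (I : Type) (s : seq I) (F : I -> K) (r : R) :
  0 <= r -> (forall i, abs (F i) <= r) -> abs (\sum_(i <- s) F i) <= r.
Proof.
move=> r0 h; elim/big_ind: _ => [|x y hx hy|//]; first by rewrite abs0.
by apply: (le_trans (absD _ _)); rewrite ge_max hx.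
Qed.

Section norms.
Context {n : nat}.
Implicit Types (x y : 'cV[K]_n) (A B : 'M[K]_n).
Local Notation vn := (vnorm abs).
Local Notation mn := (mnorm abs).

Lemma vnorm_ge0 x : 0 <= vn x.
Proof. by rewrite /vnorm; elim/big_ind: _ => [|a b ha hb|i _]; rewrite ?le_max ?ha ?abs_ge0. Qed.

Lemma vnorm_leP x r : 0 <= r -> reflect (forall i, abs (x i ord0) <= r) (vn x <= r).
Proof.
move=> r0; apply: (iffP (bigmax_leP _ _ _ _)) => [[_ h] i|h]; first exact: h.
by split => // i _; exact: h.
Qed.

Lemma vnorm_entry x i : abs (x i ord0) <= vn x.
Proof. by apply/vnorm_leP => //; exact: vnorm_ge0. Qed.

Lemma mnorm_ge0 A : 0 <= mn A.
Proof.
rewrite /mnorm; elim/big_ind: _ => [|a b ha hb|i _]; rewrite ?le_max ?ha //.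
by elim/big_ind: _ => [|a b ha hb|j _]; rewrite ?le_max ?ha ?abs_ge0.
Qed.

Lemma mnorm_leP A r : 0 <= r -> reflect (forall i j, abs (A i j) <= r) (mn A <= r).
Proof.
move=> r0; apply: (iffP (bigmax_leP _ _ _ _)) => [[_ h] i j|h].
  by have /bigmax_leP[_ ->] := h i isT.
by split => // i _; apply/bigmax_leP; split => // j _; exact: h.
Qed.

Lemma mnorm_entry A i j : abs (A i j) <= mn A.
Proof. by move: i j; apply/mnorm_leP => //; exact: mnorm_ge0. Qed.

Lemma vnorm0 : vn (0 : 'cV[K]_n) = 0.
Proof.
by apply/eqP; rewrite eq_le vnorm_ge0 andbT; apply/vnorm_leP => // i; rewrite mxE abs0.
Qed.

Lemma vnorm_eq0 x : (vn x == 0) = (x == 0).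
Proof.
apply/eqP/eqP => [h|->]; last exact: vnorm0.
apply/matrixP => i j; rewrite (ord1 j) mxE; apply/eqP.
by rewrite -abs_eq0 eq_le abs_ge0 -h vnorm_entry.
Qed.

Lemma vnorm_gt0 x : (0 < vn x) = (x != 0).
Proof. by rewrite lt_def vnorm_ge0 vnorm_eq0 andbT. Qed.

Lemma vnormD x y : vn (x + y) <= Num.max (vn x) (vn y).
Proof.
apply/vnorm_leP => [|i]; first by rewrite le_max vnorm_ge0.
rewrite mxE; apply: (le_trans (absD _ _)).
by rewrite ge_max !le_max !vnorm_entry orbT.
Qed.

Lemma vnormN x : vn (- x) = vn x.
Proof. by rewrite /vnorm; apply: eq_bigr => i _; rewrite mxE absN. Qed.

Lemma vnormB x y : vn (x - y) <= Num.max (vn x) (vn y).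
Proof. by rewrite -(vnormN y); exact: vnormD. Qed.

Lemma vnorm_subC x y : vn (x - y) = vn (y - x).
Proof. by rewrite -vnormN opprB. Qed.

Lemma vnorm_eq x y : vn (x - y) < vn x -> vn y = vn x.
Proof.
move=> h; apply/eqP; rewrite eq_le; apply/andP; split.
  have -> : y = x - (x - y) by rewrite opprB addrC subrK.
  by apply: (le_trans (vnormB _ _)); rewrite ge_max lexx ltW.
have := vnormD (x - y) y; rewrite subrK le_max => /orP[h'|//].
by have := lt_le_trans h h'; rewrite ltxx.
Qed.

Lemma vnormZ c x : vn (c *: x) = abs c * vn x.
Proof.
have le a y : vn (a *: y) <= abs a * vn y.
  apply/vnorm_leP => [|i]; first by rewrite mulr_ge0 ?abs_ge0 ?vnorm_ge0.
  by rewrite mxE absM ler_wpM2l ?abs_ge0 ?vnorm_entry.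
apply/eqP; rewrite eq_le le /=.
have [->|c0] := eqVneq c 0; first by rewrite abs0 mul0r vnorm_ge0.
have a0 : 0 < abs c by rewrite lt_def abs_ge0 abs_eq0 c0.
have := le c^-1 (c *: x); rewrite scalerA mulVf // scale1r absV.
by rewrite mulrC ler_pdivlMr // mulrC.
Qed.

Lemma vnorm_mulmx A x : vn (A *m x) <= mn A * vn x.
Proof.
have h : 0 <= mn A * vn x by rewrite mulr_ge0 ?mnorm_ge0 ?vnorm_ge0.
apply/vnorm_leP => // i; rewrite mxE; apply: abs_sum_le => // j.
by rewrite absM ler_pM ?abs_ge0 ?mnorm_entry ?vnorm_entry.
Qed.

Lemma mnorm_le_op A r : 0 <= r -> (forall x, vn (A *m x) <= r * vn x) -> mn A <= r.
Proof.
move=> r0 h; apply/mnorm_leP => // i j.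
have := h (delta_mx j ord0); rewrite -colE.
have -> : vn (delta_mx j ord0) = 1.
  apply/eqP; rewrite eq_le; apply/andP; split.
    apply/vnorm_leP => // k; rewrite mxE andbT.
    by case: eqP; rewrite ?abs1 ?abs0 ?ler01.
  by have := vnorm_entry (delta_mx j ord0) j; rewrite mxE !eqxx abs1.
by rewrite mulr1; apply: le_trans; have := vnorm_entry (col j A) i; rewrite mxE.
Qed.

Lemma mnormD A B : mn (A + B) <= Num.max (mn A) (mn B).
Proof.
apply/mnorm_leP => [|i j]; first by rewrite le_max mnorm_ge0.
rewrite mxE; apply: (le_trans (absD _ _)).
by rewrite ge_max !le_max !mnorm_entry orbT.
Qed.

Lemma mnormN A : mn (- A) = mn A.
Proof. by rewrite /mnorm; apply: eq_bigr => i _; apply: eq_bigr => j _; rewrite mxE absN. Qed.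

Lemma mnorm_subC A B : mn (A - B) = mn (B - A).
Proof. by rewrite -mnormN opprB. Qed.

Lemma vnorm_valueP x : x != 0 -> exists g : int, vn x = P ^ g.
Proof.
move=> x0; have vx : 0 < vn x by rewrite vnorm_gt0.
have : exists i, vn x <= abs (x i ord0).
  apply/not_existsP => h; have : vn x < vn x; last by rewrite ltxx.
  rewrite {1}/vnorm; apply/bigmax_ltP; split => // i _.
  by rewrite ltNge; apply/negP; exact: h.
move=> [i hi]; have e : vn x = abs (x i ord0).
  by apply/eqP; rewrite eq_le hi vnorm_entry.
rewrite e; apply: abs_valueP; rewrite -abs_eq0 -e gt_eqF //.
Qed.

Lemma mnorm_valueP A : 0 < mn A -> exists g : int, mn A = P ^ g.
Proof.
move=> A0.
have : exists i j, mn A <= abs (A i j).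
  apply/not_existsP => h; have : mn A < mn A; last by rewrite ltxx.
  rewrite {1}/mnorm; apply/bigmax_ltP; split => // i _.
  apply/bigmax_ltP; split => // j _.
  by rewrite ltNge; apply/negP => hij; apply: (h i); exists j.
move=> [i [j hij]]; have e : mn A = abs (A i j).
  by apply/eqP; rewrite eq_le hij mnorm_entry.
by rewrite e; apply: abs_valueP; rewrite -abs_eq0 -e gt_eqF.
Qed.

Lemma mnorm_invmx_gt0 A : (0 < n)%N -> A \in unitmx -> 0 < mn (invmx A).
Proof.
move=> n0 uA; rewrite lt_def mnorm_ge0 andbT; apply/eqP => h.
have := vnorm_mulmx (invmx A) (A *m const_mx 1).
rewrite mulKmx // h mul0r => h'.
have : vn (const_mx 1 : 'cV[K]_n) == 0 by rewrite eq_le h' vnorm_ge0.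
rewrite vnorm_eq0 => /eqP/matrixP/(_ (Ordinal n0) ord0)/eqP.
by rewrite !mxE oner_eq0.
Qed.

(* [B = A (1 + E)] with [E = A^-1 (B - A)] of norm < 1, and [1 + E] is an isometry. *)
Lemma unitmx_near A B : A \in unitmx -> mn (invmx A) * mn (B - A) < 1 ->
  B \in unitmx /\ mn (invmx B) <= mn (invmx A).
Proof.
move=> uA h.
have iso u : vn (invmx A *m (B *m u)) = vn u.
  have [->|u0] := eqVneq u 0; first by rewrite !mulmx0.
  apply: vnorm_eq; rewrite -{1}(mulKmx uA u) -mulmxBr -mulmxBl.
  apply: (le_lt_trans (vnorm_mulmx _ _)).
  apply: (@le_lt_trans _ _ (mn (invmx A) * mn (B - A) * vn u)).
    by rewrite -mulrA ler_wpM2l ?mnorm_ge0 // mnorm_subC vnorm_mulmx.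
  by rewrite gtr_pMl // vnorm_gt0.
have uB : B \in unitmx.
  rewrite -unitmx_tr -row_free_unit; apply/inj_row_free => v hv.
  have := iso v^T; rewrite -[B]trmxK -trmx_mul hv trmx0 mulmx0 vnorm0 => /esym/eqP.
  by rewrite vnorm_eq0 => /eqP e; rewrite -[v]trmxK e trmx0.
split => //; apply: mnorm_le_op => [|x]; first exact: mnorm_ge0.
by rewrite -iso mulKVmx // vnorm_mulmx.
Qed.

End norms.
End valued_field.

(** * Measurability *)

(** This plays the role of second countability: an open set is the union of the countably many balls
    with centres [s i] and radii [e k] that it contains. The distance is abstract so that the lemma
    serves vectors, matrices and pairs of both. *)
Lemma measurable_preimage_open (R : realType) d (T : measurableType d) (E : Type)
    (I : countType) (s : I -> E) (dist : E -> E -> R) (f : T -> E) (e : nat -> R) (U : set E) :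
  (forall x y, dist x y = dist y x) ->
  (forall x y z, dist x z <= Num.max (dist x y) (dist y z)) ->
  (forall k, 0 < e k) -> (forall r, 0 < r -> exists k, e k < r) ->
  (forall x r, 0 < r -> exists i, dist x (s i) < r) ->
  (forall i k, measurable [set t | dist (f t) (s i) <= e k]) ->
  (forall x, U x -> exists2 r, 0 < r & forall y, dist x y < r -> U y) ->
  measurable (f @^-1` U).
Proof.
move=> dC dtri e0 esmall dense mball openU.
pose F (ik : I * nat) := if `[< forall y, dist y (s ik.1) <= e ik.2 -> U y >]
  then [set t | dist (f t) (s ik.1) <= e ik.2] else set0.
have -> : f @^-1` U = \bigcup_ik F ik.
  apply/seteqP; split => [t /= Uft|t [[i k] _]].
    have [r r0 hr] := openU _ Uft; have [k hk] := esmall _ r0.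
    have [i hi] := dense (f t) (e k) (e0 k).
    (* With [e k < r] and [f t] within [e k] of [s i], the whole closed ball about [s i] lies within
       [r] of [f t], by the ultrametric inequality. *)
    exists (i, k) => //; rewrite /F /=; case: asboolP => [_|]; first exact: ltW.
    case => y hy; apply: hr; apply: (le_lt_trans (dtri _ (s i) _)).
    by rewrite gt_max (lt_trans hi hk) dC (le_lt_trans hy hk).
  by rewrite /F /=; case: asboolP => // h ?; exact: h.
apply: countable_bigcupT_measurable => [|[i k]]; first exact: countableP.
by rewrite /F; case: asboolP => _ //; exact: mball.
Qed.

Section measurability.
Context {p : nat} {R : realType} {K : fieldType} {abs : K -> R}.
Context (hp : prime p) (hK : is_Qp_model p abs).
Local Notation P := (p%:R : R).
Let P1 : 1 < P. Proof. exact: Qp_base_gt1. Qed.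
Let P0 : 0 < P. Proof. exact: Qp_base_gt0. Qed.

Lemma Qp_exp_unbounded (r : R) : exists k : nat, r < P ^+ k.
Proof.
exists (Num.bound `|r|); apply: (le_lt_trans (ler_norm r)).
apply: (lt_le_trans (archi_boundP (normr_ge0 r))).
by rewrite -natrX ler_nat ltnW // ltn_expl // prime_gt1.
Qed.

Lemma Qp_expN_small (r : R) : 0 < r -> exists k : nat, P ^- k < r.
Proof.
move=> r0; have [k hk] := Qp_exp_unbounded r^-1; exists k.
by rewrite invf_plt ?posrE ?exprn_gt0.
Qed.

Context {n : nat}.
Implicit Types (x y a : 'cV[K]_n) (M : 'M[K]_n).
Local Notation V := (Qpn abs p n).
Local Notation vn := (vnorm abs).
Local Notation mn := (mnorm abs).

Lemma measurable_closed_ball a (g : int) : measurable [set x : V | vn ((x : 'cV[K]_n) - a) <= P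
    ^ g].
Proof. by apply: sub_sigma_algebra; exists a, g. Qed.

Lemma vnorm_tri x y z : vn (x - z) <= Num.max (vn (x - y)) (vn (y - z)).
Proof. by rewrite -{1}(subrK y x) -addrA; exact: (vnormD hK). Qed.

Lemma mnorm_tri M M1 M2 : mn (M - M2) <= Num.max (mn (M - M1)) (mn (M1 - M2)).
Proof. by rewrite -{1}(subrK M1 M) -addrA; exact: (mnormD hK). Qed.

Lemma vnorm_dense x (r : R) : 0 < r -> exists v : 'cV[rat]_n, vn (x - map_mx ratr v) < r.
Proof.
move=> r0; have /choice[v hv] := fun i => ratr_dense hK (x i ord0) r0.
exists (\col_i v i); apply/bigmax_ltP; split => // i _.
by rewrite !mxE.
Qed.

Lemma mnorm_dense M (r : R) : 0 < r -> exists A : 'M[rat]_n, mn (M - map_mx ratr A) < r.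
Proof.
move=> r0; have /choice[v hv] := fun ij => ratr_dense hK (M ij.1 ij.2) r0.
exists (\matrix_(i, j) v (i, j)); apply/bigmax_ltP; split => // i _.
by apply/bigmax_ltP; split => // j _; rewrite !mxE; exact: (hv (i, j)).
Qed.

Section target.
Context d (T : measurableType d).

Lemma measurable_fun_Qpn (f : T -> V) :
  (forall a (g : int), measurable [set t | vn ((f t : 'cV[K]_n) - a) <= P ^ g]) ->
  measurable_fun setT f.
Proof.
move=> h; apply: (@measurability _ _ T V setT f (padic_balls abs p n)) => //.
by move=> _ [_ [a [g ->]] <-]; rewrite setTI; exact: h.
Qed.

Lemma measurable_fun_lt (f : T -> R) :
  (forall r, measurable [set t | f t < r]) -> measurable_fun setT f.
Proof.
move=> h; apply: (measurability _ (measurable_realfun.RGenInftyO.measurableE R)) => //.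
move=> _ [_ [r ->] <-]; rewrite setTI.
suff -> : f @^-1` `]-oo, r[ = [set t | f t < r] by exact: h.
by apply/seteqP; split => t /=; rewrite in_itv.
Qed.

(** The condition [meas_mx] over an arbitrary measurable space, so that it also covers constant
    matrices and matrices depending on one coordinate of a product. *)
Definition measurable_mx (A : T -> 'M[K]_n) :=
  forall j k (a : K) (r : R), measurable [set t | abs (A t j k - a) <= r].

Lemma measurable_mx_ball A M r : measurable_mx A -> 0 <= r ->
  measurable [set t | mn (A t - M) <= r].
Proof.
move=> mA r0.
have -> : [set t | mn (A t - M) <= r] =
    \bigcap_(ij in [set: 'I_n * 'I_n]) [set t | abs (A t ij.1 ij.2 - M ij.1 ij.2) <= r].
  apply/seteqP; split => [t /= /(mnorm_leP _ r0) h [i j] _|t /= h].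
    by have := h i j; rewrite !mxE.
  by apply/(mnorm_leP _ r0) => i j; rewrite !mxE; exact: (h (i, j)).
by apply: fin_bigcap_measurable => // -[i j] _; exact: mA.
Qed.

Lemma measurable_mx_open A (U : set 'M[K]_n) : measurable_mx A ->
  (forall M, U M -> exists2 r, 0 < r & forall M', mn (M - M') < r -> U M') ->
  measurable [set t | U (A t)].
Proof.
move=> mA oU; change (measurable (A @^-1` U)).
apply: (@measurable_preimage_open R _ T _ ('M[rat]_n) (map_mx ratr)
  (fun M M' => mn (M - M')) A (fun k => P ^- k) U) => //.
- exact: (mnorm_subC hK).
- exact: mnorm_tri.
- by move=> k; rewrite invr_gt0 exprn_gt0.
- exact: Qp_expN_small.
- exact: mnorm_dense.
- by move=> i k; apply: measurable_mx_ball => //; rewrite invr_ge0 exprn_ge0 ?ltW.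
Qed.

Lemma measurable_fun_mnorm A : measurable_mx A -> measurable_fun setT (fun t => mn (A t)).
Proof.
move=> mA; apply: measurable_fun_lt => r.
apply: (measurable_mx_open mA (U := [set M | mn M < r])) => M /= hM.
exists r => [|M' h]; first by apply: le_lt_trans hM; exact: (mnorm_ge0 hK).
rewrite -(subKr M M'); apply: (le_lt_trans (mnormD hK _ _)).
by rewrite (mnormN hK) gt_max hM.
Qed.

Lemma measurable_unitmx A : measurable_mx A -> measurable [set t | A t \in unitmx].
Proof.
move=> mA; apply: (measurable_mx_open mA (U := [set M | M \in unitmx])) => M /= uM.
(* Within this radius [|M^-1| |M' - M| < 1], as [unitmx_near] requires; the summand 1 keeps the
   radius positive even if [|M^-1| = 0]. *)
exists (1 + mn (invmx M))^-1 => [|M'].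
  by rewrite invr_gt0 ltr_pwDl ?ltr01 // (mnorm_ge0 hK).
have h0 : 0 < 1 + mn (invmx M) by rewrite ltr_pwDl ?ltr01 // (mnorm_ge0 hK).
rewrite (mnorm_subC hK) => h.
apply: (proj1 (unitmx_near hK uM _)).
apply: (@le_lt_trans _ _ ((1 + mn (invmx M)) * mn (M' - M))).
  by rewrite ler_wpM2r ?(mnorm_ge0 hK) // lerDr.
by rewrite mulrC -ltr_pdivlMr // div1r.
Qed.

Lemma measurable_fun_mnorm_inv A : measurable_mx A ->
  measurable_fun setT (fun t => mn (invmx (A t))).
Proof.
move=> mA; apply: measurable_fun_lt => r.
(* [invmx] returns a singular matrix unchanged, so the sublevel set splits into an open condition on
   invertible matrices and a condition on [|A t|] on the singular ones. *)
have -> : [set t | mn (invmx (A t)) < r] =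
    [set t | A t \in unitmx /\ mn (invmx (A t)) < r] `|`
    (~` [set t | A t \in unitmx] `&` [set t | mn (A t) < r]).
  apply/seteqP; split => [t /= h|t /= [[]//|[/negP nu]]].
    have [u|/negP nu] := boolP (A t \in unitmx); first by left.
    by right; split => //; move: h; rewrite invmx_out //; exact/negP.
  by rewrite invmx_out.
apply: measurableU.
  apply: (measurable_mx_open mA (U := [set M | M \in unitmx /\ mn (invmx M) < r])) => M /= [uM hM].
  have h0 : 0 < 1 + mn (invmx M) by rewrite ltr_pwDl ?ltr01 // (mnorm_ge0 hK).
  exists (1 + mn (invmx M))^-1 => [|M'].
    by rewrite invr_gt0.
  rewrite (mnorm_subC hK) => h.
  have [u' h'] : M' \in unitmx /\ mn (invmx M') <= mn (invmx M).
    apply: (unitmx_near hK uM).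
    apply: (@le_lt_trans _ _ ((1 + mn (invmx M)) * mn (M' - M))).
      by rewrite ler_wpM2r ?(mnorm_ge0 hK) // lerDr.
    by rewrite mulrC -ltr_pdivlMr // div1r.
  by split => //; exact: le_lt_trans hM.
apply: measurableI; first by apply: measurableC; exact: measurable_unitmx.
have := measurable_fun_mnorm mA measurableT (measurable_itv `]-oo, r[).
rewrite setTI; congr measurable; by apply/seteqP; split => t /=; rewrite in_itv.
Qed.

Lemma measurable_ball_preimage (x : T -> V) (a : 'cV[K]_n) (k : nat) : measurable_fun setT x ->
  measurable [set t | vn ((x t : 'cV[K]_n) - a) <= P ^- k].
Proof.
move=> mx; have := mx measurableT _ (measurable_closed_ball a (- k%:Z)).
by rewrite setTI -exprnN.
Qed.

Lemma measurable_fun_vnorm (x : T -> V) : measurable_fun setT x ->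
  measurable_fun setT (fun t => vn (x t : 'cV[K]_n)).
Proof.
move=> mx; apply: measurable_fun_lt => r.
apply: (@measurable_preimage_open R _ T _ ('cV[rat]_n) (map_mx ratr)
  (fun y z => vn (y - z)) x (fun k => P ^- k) [set y : 'cV[K]_n | vn y < r]) => //.
- exact: (vnorm_subC hK).
- exact: vnorm_tri.
- by move=> k; rewrite invr_gt0 exprn_gt0.
- exact: Qp_expN_small.
- exact: vnorm_dense.
- by move=> i k; exact: measurable_ball_preimage.
- move=> y /= hy; exists r => [|z h]; first by apply: le_lt_trans hy; exact: (vnorm_ge0 hK).
  rewrite -(subKr y z); apply: (le_lt_trans (vnormD hK _ _)).
  by rewrite (vnormN hK) gt_max hy.
Qed.

(** The product [M y] is jointly continuous, so the preimage of a ball is open for the maximum of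
    the two distances on pairs. *)
Lemma measurable_fun_mulmx A (x : T -> V) : measurable_mx A -> measurable_fun setT x ->
  measurable_fun setT (fun t => (A t *m (x t : 'cV[K]_n)) : V).
Proof.
move=> mA mx; apply: measurable_fun_Qpn => a g.
pose U := [set My : 'M[K]_n * 'cV[K]_n | vn (My.1 *m My.2 - a) <= P ^ g].
change (measurable ((fun t => (A t, x t : 'cV[K]_n)) @^-1` U)).
apply: (@measurable_preimage_open R _ T _ ('M[rat]_n * 'cV[rat]_n)%type
  (fun v => (map_mx ratr v.1, map_mx ratr v.2))
  (fun v w => Num.max (mn (v.1 - w.1)) (vn (v.2 - w.2))) _ (fun k => P ^- k)) => //.
- by move=> v w; rewrite (vnorm_subC hK) (mnorm_subC hK).
- move=> v w z; rewrite ge_max; apply/andP; split.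
    apply: (le_trans (mnorm_tri _ w.1 _)).
    by rewrite ge_max !le_max !lexx !orbT.
  apply: (le_trans (vnorm_tri _ w.2 _)).
  by rewrite ge_max !le_max !lexx !orbT.
- by move=> k; rewrite invr_gt0 exprn_gt0.
- exact: Qp_expN_small.
- move=> [M y] r r0; have [B hB] := mnorm_dense M r0; have [z hz] := vnorm_dense y r0.
  by exists (B, z); rewrite gt_max hB.
- move=> [B z] k /=.
  rewrite (_ : [set t | _] = [set t | mn (A t - map_mx ratr B) <= P ^- k] `&`
      [set t | vn ((x t : 'cV[K]_n) - map_mx ratr z) <= P ^- k]).
    apply: measurableI; last exact: measurable_ball_preimage.
    by apply: measurable_mx_ball => //; rewrite invr_ge0 exprn_ge0 ?ltW.
  by apply/seteqP; split => t /=; rewrite ge_max => /andP.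
- move=> [M y]; rewrite /U /= => h.
  have c0 : 0 < 1 + mn M + vn y.
    by rewrite -addrA ltr_pwDl ?ltr01 // addr_ge0 ?(mnorm_ge0 hK) ?(vnorm_ge0 hK).
  have Pg : 0 < P ^ g by rewrite exprz_gt0.
  (* The bound 1 keeps [|M'|] below [1 + |M| + |y|]; the other bound then makes both [M' (y' - y)]
     and [(M' - M) y] at most [p^g]. *)
  exists (Num.min 1 (P ^ g / (1 + mn M + vn y))) => [|[M' y'] /=].
    by rewrite lt_min ltr01 divr_gt0.
  rewrite lt_min !gt_max => /andP[/andP[M1 y1] /andP[M2 y2]].
  have -> : M' *m y' - a = M' *m (y' - y) + ((M' - M) *m y + (M *m y - a)).
    by rewrite mulmxBr mulmxBl !addrA subrK subrK.
  apply: (le_trans (vnormD hK _ _)); rewrite ge_max; apply/andP; split; last first.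
    apply: (le_trans (vnormD hK _ _)); rewrite ge_max h andbT.
    apply: (le_trans (vnorm_mulmx hK _ _)).
    rewrite (mnorm_subC hK) in M2.
    apply: (@le_trans _ _ (P ^ g / (1 + mn M + vn y) * vn y)).
      by rewrite ler_wpM2r ?(vnorm_ge0 hK) // ltW.
    rewrite mulrAC ler_pdivrMr // ler_pM2l // lerDr.
    by rewrite addr_ge0 ?ler01 ?(mnorm_ge0 hK).
  apply: (le_trans (vnorm_mulmx hK _ _)).
  have hM' : mn M' <= 1 + mn M + vn y.
    rewrite -(subKr M M') ; apply: (le_trans (mnormD hK _ _)).
    rewrite (mnormN hK) ge_max -addrA; apply/andP; split.
      by rewrite addrCA lerDl addr_ge0 ?ler01 ?(vnorm_ge0 hK).
    by apply: (le_trans (ltW M1)); rewrite lerDl addr_ge0 ?(mnorm_ge0 hK) ?(vnorm_ge0 hK).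
  rewrite (vnorm_subC hK) in y2.
  apply: (@le_trans _ _ ((1 + mn M + vn y) * vn (y' - y))).
    by rewrite ler_wpM2r ?(vnorm_ge0 hK).
  by rewrite mulrC -ler_pdivlMr // ltW.
Qed.
End target.
End measurability.

(** * Translation-invariant measures *)

Lemma fsbig_setT_finType (T : finType) (V : nmodType) (F : T -> V) :
  \sum_(i \in [set: T]) F i = \sum_i F i.
Proof.
rewrite fsbig_finite //=; apply: perm_big; apply: uniq_perm.
- exact: finmap.fset_uniq.
- by rewrite index_enum_uniq.
- move=> i; transitivity true; first by rewrite in_fset_set ?mem_setE; [exact/mem_set|exact:
    finite_finset].
  by rewrite [RHS]mem_index_enum.
Qed.

Section haar.
Context {p : nat} {R : realType} {K : fieldType} {abs : K -> R}.
Context (hp : prime p) (hK : is_Qp_model p abs).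
Local Notation P := (p%:R : R).
Let P1 : 1 < P. Proof. exact: Qp_base_gt1. Qed.
Let P0 : 0 < P. Proof. exact: Qp_base_gt0. Qed.

Context {n : nat}.
Local Notation V := (Qpn abs p n).
Local Notation vn := (vnorm abs).
Local Notation mn := (mnorm abs).
Local Notation B := (@Bball R K abs p n).

Definition ball_at (a : 'cV[K]_n) (g : int) : set V :=
  [set x : V | vn ((x : 'cV[K]_n) - a) <= P ^ g].

Definition translation_invariant (mu : set V -> \bar R) := forall (a : 'cV[K]_n) (E : set V),
  measurable E -> mu ([set (a + (x : 'cV[K]_n)) | x in E] : set V) = mu E.

Lemma BballE g : B g = ball_at 0 g.
Proof. by apply/seteqP; split => x /=; rewrite /Bball /ball_at /= subr0. Qed.

Lemma measurable_ball_at a g : measurable (ball_at a g).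
Proof. exact: measurable_closed_ball. Qed.

Lemma measurable_Bball g : measurable (B g).
Proof. by rewrite BballE; exact: measurable_ball_at. Qed.

Lemma Qp_exp_mono (g h : int) : g <= h -> P ^ g <= P ^ h.
Proof. by move=> gh; rewrite ler_weXz2l // ltW. Qed.

Lemma ball_at_translate a g : ball_at a g = [set (a + (x : 'cV[K]_n)) | x in B g].
Proof.
apply/seteqP; split => [x hx|_ [x hx <-]].
  by exists (x - a : 'cV[K]_n) => //; rewrite addrC subrK.
by rewrite /ball_at /= addrAC subrr add0r.
Qed.

Lemma ball_at_disjoint (a b : 'cV[K]_n) g : ball_at a g `&` ball_at b g !=set0 ->
  vn (a - b) <= P ^ g.
Proof.
move=> [x [ha hb]]; apply: (le_trans (vnorm_tri hK a x b)).
by rewrite ge_max (vnorm_subC hK) ha.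
Qed.

(** Vectors of leading digits at scale [p^g], since [|p^(-g)| = p^g]: the centres of the [p^n] balls
    of radius [p^(g-1)] that make up [B g]. *)
Let ctr (g : int) (f : {ffun 'I_n -> 'I_p}) : 'cV[K]_n :=
  \col_i ((f i : nat)%:R * p%:R ^ (- g)).

Lemma ball_split (g : int) : B (g + 1) = \bigcup_(f in [set: {ffun 'I_n -> 'I_p}]) ball_at (ctr
    (g + 1) f) g.
Proof.
have Pg (h : int) : 0 < P ^ h by rewrite exprz_gt0.
apply/seteqP; split => [x hx|x [f _ hx]].
  have /choice[f hf] i : exists c : 'I_p, abs ((x : 'cV[K]_n) i ord0 - (c : nat)%:R * p%:R ^ (-
      (g + 1))) <= P ^ g.
    (* Multiplying by [p^(g+1)] makes the coordinate integral; its residue is the leading digit. *)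
    have h1 : abs ((x : 'cV[K]_n) i ord0 * p%:R ^ (g + 1)) <= 1.
      rewrite (absM hK) (abs_pX hp hK) -invr_expz ler_pdivrMr // mul1r.
      exact: (le_trans (vnorm_entry hK _ _) hx).
    have [c hc] := residue_exists hp hK h1; exists c.
    have -> : (x : 'cV[K]_n) i ord0 - c%:R * p%:R ^ (- (g + 1)) =
      ((x : 'cV[K]_n) i ord0 * p%:R ^ (g + 1) - c%:R) * p%:R ^ (- (g + 1)).
      by rewrite mulrBl -mulrA -expfzDr ?subrr ?expr0z ?mulr1 // -(expr1z p%:R) (Qp_pX_neq0 hp hK).
    rewrite (absM hK) (abs_pX hp hK) opprK.
    rewrite -ler_pdivlMr //; apply: (le_trans hc).
    by rewrite expfzDr ?gt_eqF // expr1z invfM mulrA divff ?gt_eqF // mul1r.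
  exists [ffun i => f i] => //; apply/vnorm_leP => [|i]; first exact: ltW.
  by rewrite !mxE ffunE.
rewrite /Bball /=; rewrite -(subrK (ctr (g + 1) f) (x : 'cV[K]_n)).
apply: (le_trans (vnormD hK _ _)); rewrite ge_max; apply/andP; split.
  by apply: (le_trans hx); apply: Qp_exp_mono; rewrite lerDl.
apply/vnorm_leP => [|i]; first exact: ltW.
rewrite mxE (absM hK) (abs_pX hp hK) opprK ler_piMl //; first exact: ltW.
by have := abs_intr_le1 hp hK (f i : nat).
Qed.

Lemma ball_split_triv (g : int) : trivIset setT (fun f => ball_at (ctr (g + 1) f) g).
Proof.
have Pg (h : int) : 0 < P ^ h by rewrite exprz_gt0.
move=> f f' _ _ /ball_at_disjoint h; apply/ffunP => i; apply: val_inj.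
apply: (residue_unique hK (ltn_ord _) (ltn_ord _)).
have := le_trans (vnorm_entry hK _ i) h; rewrite !mxE -mulrBl (absM hK) (abs_pX hp hK) opprK.
rewrite -ler_pdivlMr // expfzDr ?gt_eqF // invfM mulrA divff ?gt_eqF // mul1r expr1z.
by move=> /le_lt_trans; apply; rewrite invf_lt1.
Qed.

Section invariant.
Context (mu : {measure set V -> \bar R}) (mu_inv : translation_invariant mu).
Local Open Scope ereal_scope.

Lemma invariant_ball_at a g : mu (ball_at a g) = mu (B g).
Proof. by rewrite ball_at_translate; apply: mu_inv; exact: measurable_Bball. Qed.

Lemma invariant_ball_step (g : int) : mu (B (g + 1)) = (P ^+ n)%:E * mu (B g).
Proof.
rewrite ball_split measure_fin_bigcup; last 3 first.
- exact: finite_finset.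
- exact: ball_split_triv.
- by move=> f _; exact: measurable_ball_at.
rewrite fsbig_setT_finType (eq_bigr (fun=> mu (B g))); last by move=> f _; exact: invariant_ball_at.
by rewrite big_const card_ffun !card_ord iter_addr_0 -natrX mule_natl.
Qed.

Lemma invariant_Bball (g : int) : mu (B g) = ((P ^+ n) ^ g)%:E * mu (B 0).
Proof.
have Pn : (P ^+ n != 0)%R by rewrite expf_eq0 gt_eqF // andbF.
case: g => k.
  elim: k => [|k IH]; first by rewrite expr0z mul1e.
  rewrite -addn1 PoszD invariant_ball_step IH muleA -EFinM; congr (_%:E * _).
  by rewrite expfzDr // mulrC expr1z.
rewrite NegzE; elim: k => [|k IH].
  (* For negative exponents the step from [B g] to [B (g + 1)] is read backwards, dividing by
     [p^n]. *)
  have := invariant_ball_step (-1); rewrite addNr => ->.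
  by rewrite muleA -EFinM exprN1 mulVf // mul1e.
have e : ((- k.+2%:Z) + 1 = - k.+1%:Z)%R by rewrite -[in LHS]addn1 PoszD opprD subrK.
have := invariant_ball_step (- k.+2%:Z); rewrite e IH => h.
rewrite -[LHS]mul1e -(mulVf Pn) EFinM -muleA -h muleA -EFinM; congr (_%:E * _).
by rewrite -e expfzDr // expr1z mulrCA mulVf // mulr1.
Qed.

Lemma bigcup_Bball : \bigcup_(k : nat) B k%:Z = [set: V].
Proof.
apply/seteqP; split => // x _; have [k hk] := Qp_exp_unbounded hp (vn (x : 'cV[K]_n)).
by exists k => //; rewrite /Bball /= -exprnP ltW.
Qed.
End invariant.

(** Ultrametric balls are nested or disjoint; together with the empty set they therefore form a
    pi-system. *)
Lemma ball_setI a b g h : (g <= h)%R ->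
  ball_at a g `&` ball_at b h = ball_at a g \/ ball_at a g `&` ball_at b h = set0.
Proof.
move=> gh; have [e|/set0P [y [ya yb]]] := eqVneq (ball_at a g `&` ball_at b h) set0.
  by right.
left; apply/seteqP; split => [x []//|x xa]; split => //.
apply: (le_trans (vnorm_tri hK x y b)); rewrite ge_max yb andbT.
apply: (le_trans (vnorm_tri hK x a y)); rewrite ge_max.
rewrite (vnorm_subC hK a y).
by apply/andP; split; [apply: (le_trans xa)|apply: (le_trans ya)]; exact: Qp_exp_mono.
Qed.

(** Both measures scale by [p^n] from one ball to the next, so agreement on [B 0] spreads to the
    pi-system of all balls, and the balls [B k] of finite measure exhaust the space. *)
Lemma invariant_unique (mu nu : {measure set V -> \bar R}) :
  translation_invariant mu -> translation_invariant nu ->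
  mu (B 0) = nu (B 0) -> (mu (B 0) < +oo)%E ->
  forall E, measurable E -> mu E = nu E.
Proof.
move=> imu inu e fin; pose G : set (set V) := padic_balls abs p n `|` [set set0].
apply: (measure_unique G (fun k : nat => B k%:Z)).
- apply/seteqP; split.
    by apply: sub_smallest2r; [exact: smallest_sigma_algebra|move=> E ?; left].
  apply: smallest_sub; first exact: sigma_algebra_measurable.
  by move=> E [[a [g ->]]|->]; [exact: measurable_ball_at|exact: measurable0].
- move=> E F [[a [g ->]]|->]; last by rewrite set0I; right.
  case => [[b [h ->]]|->]; last by rewrite setI0; right.
  have [gh|/ltW hg] := leP g h.
    case: (ball_setI a b gh) => ->; last by right.
    by left; exists a, g.
  rewrite setIC; case: (ball_setI b a hg) => ->; last by right.
  by left; exists b, h.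
- by move=> k; left; exists 0, k%:Z; exact: BballE.
- exact: bigcup_Bball.
- move=> E [[a [g ->]]|->]; last by rewrite !measure0.
  rewrite (invariant_ball_at imu) (invariant_ball_at inu).
  by rewrite (invariant_Bball imu) (invariant_Bball inu) e.
- by move=> k; rewrite (invariant_Bball imu) lte_mul_pinfty // lee_fin exprz_ge0 // exprn_ge0 //
    ltW.
Qed.
End haar.

(** * Integration against the Haar measure *)

Section haar_integral.
Context {p : nat} {R : realType} {K : fieldType} {abs : K -> R}.
Context (hp : prime p) (hK : is_Qp_model p abs).
Local Notation P := (p%:R : R).
Let P1 : 1 < P. Proof. exact: Qp_base_gt1. Qed.
Let P0 : 0 < P. Proof. exact: Qp_base_gt0. Qed.
Context {n : nat} (n0 : (0 < n)%N).
Local Notation V := (Qpn abs p n).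
Local Notation vn := (vnorm abs).
Local Notation mn := (mnorm abs).
Local Notation B := (@Bball R K abs p n).

Lemma measurable_mx_cst d (T : measurableType d) (A : 'M[K]_n) :
  measurable_mx (abs := abs) (fun _ : T => A).
Proof.
move=> j k a r; have [h|/negP h] := boolP (abs (A j k - a) <= r).
  by rewrite (_ : [set _ | _] = setT) //; apply/seteqP; split.
by rewrite (_ : [set _ | _] = set0) //; apply/seteqP; split.
Qed.

Lemma measurable_mulmx (A : 'M[K]_n) :
  measurable_fun setT (fun x : V => (A *m (x : 'cV[K]_n)) : V).
Proof.
apply: (measurable_fun_mulmx hp hK (A := fun=> A) (x := id)).
  exact: measurable_mx_cst.
exact: measurable_id.
Qed.

Lemma measurable_vnorm : measurable_fun setT (fun x : V => vn (x : 'cV[K]_n)).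
Proof. exact: (measurable_fun_vnorm hp hK (@measurable_id _ V setT)). Qed.

Lemma measurable_wpow (a : R) : measurable_fun setT (fun x : V => wpow abs a (x : 'cV[K]_n)).
Proof. exact: (measurableT_comp (measurable_powR a) measurable_vnorm). Qed.

Lemma wpow_ge0 a (x : 'cV[K]_n) : 0 <= wpow abs a x.
Proof. exact: powR_ge0. Qed.

Context (mu : {measure set V -> \bar R}) (haar_mu : is_haar abs mu).
Let inv_mu : translation_invariant mu. Proof. by case: haar_mu. Qed.
Let mu1 : mu (B 0) = 1%E. Proof. by case: haar_mu. Qed.

Lemma haar_Bball (g : int) : mu (B g) = ((P ^+ n) ^ g)%:E.
Proof. by rewrite (invariant_Bball hp hK inv_mu) mu1 mule1. Qed.

Lemma haar_sigma_finite : sigma_finite [set: V] mu.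
Proof.
exists (fun k : nat => B k%:Z) => [|k]; first by rewrite (bigcup_Bball hp).
split; first exact: measurable_Bball.
by rewrite haar_Bball ltry.
Qed.

(** For invertible [A] this number is [|det A|^-1], encoded as the measure of the preimage of the
    unit ball. *)
Definition jacobian (A : 'M[K]_n) := mu ((fun x : V => (A *m (x : 'cV[K]_n)) : V) @^-1` B 0).

(** The preimage of the unit ball lies in the ball of radius [|A^-1|], which is an exact power of
    [p]. *)
Lemma jacobian_le A : A \in unitmx -> (jacobian A <= (mn (invmx A) ^+ n)%:E)%E.
Proof.
move=> uA; have [g hg] := mnorm_valueP hK (mnorm_invmx_gt0 hK n0 uA).
have -> : mn (invmx A) ^+ n = (P ^+ n) ^ g by rewrite hg !exprnP !exprz_exp mulrC.
rewrite -haar_Bball; apply: le_measure; rewrite ?inE.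
- by rewrite -[X in measurable X]setTI; apply: measurable_mulmx => //; exact: measurable_Bball.
- exact: measurable_Bball.
move=> x; rewrite /Bball /= expr0z -hg => h.
rewrite -(mulKmx uA (x : 'cV[K]_n)); apply: (le_trans (vnorm_mulmx hK _ _)).
by rewrite ler_piMr ?(mnorm_ge0 hK).
Qed.

(** The pushforward of [mu] under [A] is translation-invariant and has mass [jacobian A] on the unit
    ball, so by uniqueness it is that multiple of [mu]. *)
Lemma haar_change_of_variables A (f : V -> \bar R) : A \in unitmx ->
  measurable_fun setT f -> (forall x, 0 <= f x)%E ->
  (\int[mu]_x f (A *m (x : 'cV[K]_n)) = jacobian A * \int[mu]_x f x)%E.
Proof.
move=> uA mf f0; have mA := measurable_mulmx A.
have jfin : jacobian A \is a fin_num.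
  by rewrite ge0_fin_numE ?measure_ge0 // (le_lt_trans (jacobian_le uA)) ?ltry.
have c0 : (0 <= fine (jacobian A))%R by rewrite fine_ge0 ?measure_ge0.
pose nu : {measure set V -> \bar R} :=
  @measure_function.measure_function_pushforward__canonical__measure_function_Measure _ _ _ _ _
      mu _ mA.
pose mu' : {measure set V -> \bar R} := mscale (NngNum c0) mu.
have -> : (\int[mu]_x f (A *m (x : 'cV[K]_n)) = \int[nu]_x f x)%E.
  by rewrite [RHS](ge0_integral_pushforward mA mu measurableT mf (fun x _ => f0 x)).
rewrite (@eq_measure_integral _ _ _ _ mu').
  by rewrite ge0_integral_mscale //= fineK.
move=> E0 mE0 _; apply: (invariant_unique hp hK) mE0.
- move=> a E mE; rewrite /nu /= /pushforward.
  (* Translating by [a] after applying [A] amounts to translating by [A^-1 a] before. *)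
  rewrite -[RHS](inv_mu (invmx A *m a)); last first.
    by rewrite -[X in measurable X]setTI; exact: (mA measurableT _ mE).
  congr (mu _); apply/seteqP; split => [x /= [y Ey yx]|_ /= [x Ax <-]].
    exists (x - invmx A *m a : 'cV[K]_n); last by rewrite addrC subrK.
    by rewrite /= mulmxBr mulKVmx // -yx addrAC subrr add0r.
  by exists (A *m (x : 'cV[K]_n)) => //; rewrite mulmxDr mulKVmx.
- by move=> a E mE; rewrite /mu' /= /mscale inv_mu.
- by rewrite /mu' /nu /= /mscale mu1 mule1 /= fineK.
- by rewrite /nu /=; rewrite -[X in (X < _)%E]/(jacobian A) ltey_eq jfin.
Qed.

Lemma jacobian_scalar (g : int) : jacobian (p%:R ^ g)%:M = ((P ^+ n) ^ g)%:E.
Proof.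
rewrite -haar_Bball; congr (mu _); apply/seteqP; split => x;
  by rewrite /Bball /= expr0z mul_scalar_mx (vnormZ hK) (abs_pX hp hK) -invr_expz ler_pdivrMl
      ?exprz_gt0 // mulr1.
Qed.

Lemma measurable_set0cV : measurable [set (0 : 'cV[K]_n) : V].
Proof.
have := measurable_vnorm measurableT (measurable_set1 0); rewrite setTI.
suff -> : (fun x : V => vn (x : 'cV[K]_n)) @^-1` [set 0] = [set (0 : 'cV[K]_n) : V] by [].
by apply/seteqP; split => x /= => [/eqP|->]; rewrite ?(vnorm0 hK) // (vnorm_eq0 hK) => /eqP.
Qed.

Lemma haar_set0 : mu [set (0 : 'cV[K]_n)] = 0%E.
Proof.
apply/eqP; rewrite eq_le measure_ge0 andbT; apply/lee_addgt0Pr => e e0; rewrite add0e.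
have [k hk] := Qp_expN_small hp e0.
apply: (@le_trans _ _ (mu (B (- k%:Z)))).
  apply: le_measure; rewrite ?inE; [exact: measurable_set0cV|exact: measurable_Bball|].
  by move=> _ ->; rewrite /Bball /= (vnorm0 hK) exprz_ge0 // ltW.
rewrite haar_Bball lee_fin -exprnN; apply: le_trans (ltW hk).
rewrite lef_pV2 ?posrE ?exprn_gt0 // -exprM ler_weXn2l ?leq_pmull //.
exact: ltW.
Qed.

(** Multiplication by the scalar [p^g] carries [B g] onto [B 0]: the weight contributes [p^(g a)]
    and the Jacobian [p^(g n)]. *)
Lemma wball_scale a (g : int) :
  (wball mu a g = (P `^ (g%:~R * (a + n%:R)))%:E * wball mu a 0)%E.
Proof.
pose f (x : V) := (((fun x : V => (wpow abs a (x : 'cV[K]_n))%:E) \_ (B 0)) x)%E.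
have mw : measurable_fun setT (fun x : V => (wpow abs a (x : 'cV[K]_n))%:E).
  by apply/measurable_EFinP; exact: measurable_wpow.
have mf : measurable_fun setT f.
  apply/(measurable_restrictT _ _).1; first exact: measurable_Bball.
  exact: measurable_funTS.
have f0 x : (0 <= f x)%E by apply: erestrict_ge0 => y _; rewrite lee_fin wpow_ge0.
have u : (p%:R ^ g)%:M \in (@unitmx K n).
  by rewrite -scalemx1 unitmxZ ?unitmx1 // unitfE (Qp_pX_neq0 hp hK).
have := haar_change_of_variables u mf f0.
rewrite jacobian_scalar.
have <- : wball mu a 0 = (\int[mu]_x f x)%E by rewrite /wball integral_mkcond.
have Pg (h : int) : 0 < P ^ h by rewrite exprz_gt0.
have -> : (\int[mu]_x f ((p%:R ^ g)%:M *m (x : 'cV[K]_n)) = (P `^ (- (g%:~R * a)))%:E * wball mu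
    a g)%E.
  rewrite /wball -ge0_integralZl ?lee_fin ?powR_ge0 //; last 3 first.
  - exact: measurable_Bball.
  - exact: measurable_funTS.
  - by move=> x _; rewrite lee_fin wpow_ge0.
  rewrite [RHS]integral_mkcond; apply: eq_integral => x _.
  rewrite /f !patchE mul_scalar_mx.
  have -> : ((p%:R ^ g *: (x : 'cV[K]_n) : V) \in B 0) = (x \in B g).
    by apply/idP/idP; rewrite !inE /Bball /= expr0z (vnormZ hK) (abs_pX hp hK) -invr_expz
        ler_pdivrMl // mulr1.
  case: ifP => // _; rewrite /wpow (vnormZ hK) (abs_pX hp hK) powRM ?(vnorm_ge0 hK) ?(ltW (Pg
      _)) //.
  by rewrite EFinM -powR_intmul ?ltW // -powRrM intrN mulNr.
move=> h.
rewrite mulrDr powRD; last by apply/implyP => _; rewrite gt_eqF.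
have -> : P `^ (g%:~R * n%:R) = (P ^+ n) ^ g.
  by rewrite mulrC powRrM powR_mulrn ?ltW // powR_intmul // exprn_ge0 // ltW.
rewrite EFinM -muleA -h muleA -EFinM -powRD ?subrr ?powRr0 ?mul1e //.
by rewrite eqxx gt_eqF.
Qed.

(** * Spheres around the origin and integrability of the power weights *)

Definition shell (k : nat) : set V := B (- k%:Z) `\` B (- k.+1%:Z).

Lemma measurable_shell k : measurable (shell k).
Proof. by apply: measurableD; exact: measurable_Bball. Qed.

Lemma vnorm_shell k (x : V) : shell k x -> vn (x : 'cV[K]_n) = P ^ (- k%:Z).
Proof.
have Pg (h : int) : 0 < P ^ h by rewrite exprz_gt0.
move=> [h1 /negP]; rewrite -ltNge => h2.
have x0 : (x : 'cV[K]_n) != 0.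
  by rewrite -(vnorm_eq0 hK) gt_eqF // (le_lt_trans _ h2) // ltW.
have [g e] := vnorm_valueP hK x0; move: h1 h2; rewrite /Bball /= e.
rewrite ler_eXz2l // ltr_eXz2l // => h1 h2; congr (_ ^ _); apply/eqP.
rewrite eq_le h1 /= -lezD1 in h2 *; apply: le_trans h2 => //.
by rewrite -[in X in _ <= X]addn1 PoszD opprD addrNK.
Qed.

Lemma shell_vnorm (x : V) : (x : 'cV[K]_n) != 0 -> B 0 x -> exists k, shell k x.
Proof.
move=> x0; have [g e] := vnorm_valueP hK x0; rewrite /shell /Bball /= e ler_eXz2l // => g0.
exists `|g|%N; rewrite !ler_eXz2l // lez0_abs // opprK; split => //.
apply/negP; rewrite -ltNge -addn1 PoszD lez0_abs // opprD opprK.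
by rewrite ltrBlDr ltrDl.
Qed.

Lemma haar_shell_le k : (mu (shell k) <= (P ^- (n * k))%:E)%E.
Proof.
have -> : P ^- (n * k) = (P ^+ n) ^ (- k%:Z) by rewrite exprM exprnN.
rewrite -haar_Bball; apply: le_measure; rewrite ?inE.
- exact: measurable_shell.
- exact: measurable_Bball.
- exact: subDsetl.
Qed.

Lemma haar_shell0_gt0 : (0 < mu (shell 0))%E.
Proof.
have -> : shell 0 = B 0 `\` B (-1) by rewrite /shell oppr0.
have -> : (mu (B 0 `\` B (-1)) = mu (B 0) - mu (B 0 `&` B (-1)))%E.
  apply: measureD; [exact: measurable_Bball|exact: measurable_Bball|].
  by have := ltry (1 : R); rewrite -mu1.
rewrite setIidr; last by move=> x; rewrite /Bball /= => /le_trans; apply; apply: (Qp_exp_mono hp).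
rewrite !haar_Bball expr0z -EFinB lte_fin subr_gt0 exprN1 invf_lt1 ?exprn_gt0 //.
by rewrite exprn_egt1 // -lt0n.
Qed.

Lemma integral_shell a k :
  (\int[mu]_(x in shell k) (wpow abs a (x : 'cV[K]_n))%:E = (P `^ (- (k%:R * a)))%:E * mu (shell
      k))%E.
Proof.
rewrite -integral_cst; last exact: measurable_shell.
apply: eq_integral => x /set_mem/vnorm_shell e; congr EFin.
by rewrite /wpow e -powR_intmul ?ltW // -powRrM intrN mulNr.
Qed.

Lemma wball0_gt0 a : (0 < wball mu a 0)%E.
Proof.
apply: (@lt_le_trans _ _ (\int[mu]_(x in shell 0) (wpow abs a (x : 'cV[K]_n))%:E)%E).
  by rewrite integral_shell mul0r oppr0 powRr0 mul1e haar_shell0_gt0.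
apply: ge0_subset_integral => //.
- exact: measurable_shell.
- exact: measurable_Bball.
- by apply: measurable_funTS; apply/measurable_EFinP; exact: measurable_wpow.
- by move=> x _; rewrite lee_fin wpow_ge0.
- by rewrite /shell oppr0; exact: subDsetl.
Qed.

Lemma bigcup_shell : \bigcup_k shell k = B 0 `\` [set (0 : 'cV[K]_n) : V].
Proof.
apply/seteqP; split => [x [k _ hx]|x [Bx /eqP x0]]; last first.
  by have [k hk] := shell_vnorm x0 Bx; exists k.
have e := vnorm_shell hx; split.
  by rewrite /Bball /= e ler_eXz2l // oppr_le0.
move=> x0; move: e; rewrite x0 (vnorm0 hK) => /esym/eqP.
by rewrite gt_eqF // exprz_gt0.
Qed.

Lemma wball0_lty a : - n%:R < a -> (wball mu a 0 < +oo)%E.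
Proof.
move=> an.
have mw D : measurable_fun D (fun x : V => (wpow abs a (x : 'cV[K]_n))%:E).
  by apply: measurable_funTS; apply/measurable_EFinP; exact: measurable_wpow.
(* The shells cover the unit ball except for the origin, which is null. *)
rewrite /wball (ge0_negligible_integral measurable_set0cV _ _ _ haar_set0) //; last 2 first.
- exact: measurable_Bball.
- by move=> x _; rewrite lee_fin wpow_ge0.
rewrite -bigcup_shell ge0_integral_bigcup //; last 3 first.
- exact: measurable_shell.
- by move=> x _; rewrite lee_fin wpow_ge0.
- move=> i j _ _ [x [/vnorm_shell + /vnorm_shell]] => -> /eqP.
  by rewrite eq_le !ler_eXz2l // -eq_le eqr_opp => /eqP[].
(* The shell of radius [p^-k] contributes at most [p^(-k a) p^(-k n) = r^k], and [a > -n] makes the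
   geometric series converge. *)
pose r := P `^ (- (a + n%:R)).
have r0 : 0 < r by rewrite powR_gt0.
have r1 : r < 1.
  rewrite /r powRN invf_lt1 ?powR_gt0 // /powR gt_eqF // expR_gt1 mulr_gt0 ?ln_gt0 //.
  by rewrite -ltrBlDr sub0r.
apply: (@le_lt_trans _ _ (1 / (1 - r))%:E); last exact: ltry.
apply: lime_le.
  by apply: is_cvg_nneseries => k _ _; apply: integral_ge0 => x _; rewrite lee_fin wpow_ge0.
apply: nearW => N.
have h k : (\int[mu]_(x in shell k) (wpow abs a (x : 'cV[K]_n))%:E <= (geometric 1 r k)%:E)%E.
  rewrite integral_shell /geometric /= mul1r.
  apply: (@le_trans _ _ ((P `^ (- (k%:R * a)))%:E * (P ^- (n * k))%:E)%E).
    by rewrite lee_wpmul2l ?lee_fin ?powR_ge0 ?haar_shell_le.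
  rewrite -EFinM lee_fin -(powR_mulrn k (ltW r0)) -powRrM.
  rewrite -(powR_mulrn (n * k) (ltW P0)) -powRN -powRD; last by apply/implyP => _; rewrite gt_eqF.
  by rewrite mulNr mulrDl opprD natrM (mulrC a).
apply: (le_trans (lee_sum _ (fun k _ => h k))).
rewrite sumEFin lee_fin; apply: geometric_le_lim => //.
by rewrite gtr0_norm.
Qed.

End haar_integral.

(** * Inequalities *)

Section inequalities.
Context {R : realType}.

Lemma powR_le_expR (x t : R) : 0 <= x -> 0 <= t -> x `^ t <= expR (t * (x - 1)).
Proof.
move=> x0 t0; rewrite /powR; case: eqVneq => [->|xn0].
  by case: eqVneq => [->|_]; rewrite ?mul0r ?expR0 ?expR_ge0.
have xp : 0 < x by rewrite lt_def xn0.
rewrite ler_expR ler_wpM2l // lerBrDl -[leRHS](@lnK _ x) ?posrE //.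
exact: expR_ge1Dx.
Qed.

(** After division by the mean [S], each factor is at most [exp (t_i (x_i / S - 1))], and these
    exponents sum to 0. *)
Lemma weighted_AGM (I : finType) (t x : I -> R) :
  (forall i, 0 <= t i) -> \sum_i t i = 1 -> (forall i, 0 <= x i) ->
  \prod_i x i `^ t i <= \sum_i t i * x i.
Proof.
move=> t0 t1 x0; set S := \sum_i t i * x i.
have S0 : 0 <= S by apply: sumr_ge0 => i _; rewrite mulr_ge0.
(* If the mean vanishes it cannot be divided by; then some [x_i] of positive weight is 0 and kills
   the product. *)
have [Sz|Sn0] := eqVneq S 0.
  have [i ti] : exists i, t i != 0.
    apply/not_existsP => h; have : \sum_i t i = 0.
      by apply: big1 => i _; apply/eqP/negPn/negP; exact: h.
    by move/eqP; rewrite t1 oner_eq0.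
  rewrite Sz (bigD1 i) //=; have : t i * x i = 0.
    apply/eqP; move/eqP: Sz; rewrite /S psumr_eq0 => [/allP/(_ i)|j _]; last by rewrite mulr_ge0.
    by rewrite mem_index_enum; apply.
  by move/eqP; rewrite mulf_eq0 (negbTE ti) /= => /eqP ->; rewrite powR0 // mul0r.
have Sp : 0 < S by rewrite lt_def Sn0.
have -> : \prod_i x i `^ t i = S * \prod_i (x i / S) `^ t i.
  have {1}-> : S = \prod_i S `^ t i.
    rewrite /powR; under eq_bigr do rewrite (negbTE Sn0).
    by rewrite -expR_sum -mulr_suml t1 mul1r lnK ?posrE.
  rewrite -big_split /=; apply: eq_bigr => i _.
  by rewrite -powRM ?divr_ge0 // mulrC divfK.
rewrite -[leRHS]mulr1 ler_pM2l //.
apply: (@le_trans _ _ (\prod_i expR (t i * (x i / S - 1)))).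
  by apply: ler_prod => i _; rewrite powR_ge0 powR_le_expR // divr_ge0.
rewrite -expR_sum -[leRHS]expR0 ler_expR.
under eq_bigr do rewrite mulrBr mulr1 mulrA.
by rewrite sumrB t1 -mulr_suml -/S divff // subrr.
Qed.

Lemma powR_prod (I : finType) (x : I -> R) (a : R) : (forall i, 0 <= x i) ->
  (\prod_i x i) `^ a = \prod_i x i `^ a.
Proof.
move=> x0; suff [] : 0 <= \prod_i x i /\ (\prod_i x i) `^ a = \prod_i x i `^ a by [].
elim/big_ind2: _ => [|u v s t [u0 <-] [s0 <-]|i _]; rewrite ?powR1 ?ler01 //.
by rewrite mulr_ge0 // powRM.
Qed.

(** The form that integrates to Hoelder's inequality: if each [x_i] has integral at most [l_i], the
    right-hand side has integral at most the product of the [l_j] to the powers [t_j]. *)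
Lemma weighted_AGM_scaled (I : finType) (t l x : I -> R) :
  (forall i, 0 <= t i) -> \sum_i t i = 1 -> (forall i, 0 < l i) -> (forall i, 0 <= x i) ->
  \prod_i x i `^ t i <= \sum_i (\prod_j l j `^ t j) * t i / l i * x i.
Proof.
move=> t0 t1 l0 x0.
have -> : \prod_i x i `^ t i = (\prod_i l i `^ t i) * \prod_i (x i / l i) `^ t i.
  rewrite -big_split /=; apply: eq_bigr => i _.
  by rewrite -powRM ?divr_ge0 ?(ltW (l0 i)) // mulrC divfK // gt_eqF.
have xl0 i : 0 <= x i / l i by rewrite divr_ge0 // ltW.
have L0 : 0 <= \prod_i l i `^ t i by apply: prodr_ge0 => i _; exact: powR_ge0.
apply: (le_trans (ler_wpM2l L0 (weighted_AGM t0 t1 xl0))).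
rewrite mulr_sumr le_eqVlt; apply/orP; left; apply/eqP; apply: eq_bigr => i _.
by ring.
Qed.

(** AM-GM for [(h / s)^q] and 1 with weights [1/q] and [1 - 1/q]. It bounds [h] linearly in [h^q],
    hence can be integrated; [s] stays free for optimization. *)
Lemma young_powR (q s h : R) : 1 <= q -> 0 < s -> 0 <= h ->
  h <= s `^ (1 - q) / q * h `^ q + (1 - q^-1) * s.
Proof.
move=> q1 s0 h0; have q0 : 0 < q by exact: lt_le_trans q1.
have qi : 0 <= 1 - q^-1 by rewrite subr_ge0 invf_le1.
have hs0 : 0 <= h / s by rewrite divr_ge0 // ltW.
have : h / s <= q^-1 * (h / s) `^ q + (1 - q^-1).
  pose t (b : bool) := if b then q^-1 else 1 - q^-1.
  pose x (b : bool) := if b then (h / s) `^ q else 1.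
  have := @weighted_AGM _ t x; rewrite !big_bool /= powR1 /= !mulr1 -powRrM divff ?gt_eqF //.
  rewrite powRr1 //; apply.
  - by case; rewrite /t ?invr_ge0 // ltW.
  - by rewrite addrC subrK.
  - by case; rewrite /x ?powR_ge0.
rewrite ler_pdivrMr // mulrDl => /le_trans; apply; rewrite lerD2r.
have -> : (h / s) `^ q = h `^ q / s `^ q.
  by rewrite powRM ?invr_ge0 // ?ltW // -(powR_inv1 (ltW s0)) -powRrM mulN1r powRN.
rewrite powRB; last by apply/implyP => _; rewrite gt_eqF.
rewrite (powRr1 (ltW s0)) le_eqVlt; apply/orP; left; apply/eqP; field.
by rewrite !gt_eqF // powR_gt0.
Qed.

(** Young's inequality with parameter [s] is integrated against [w], and then [s] is optimized. Only
    an upper bound [M] of the total mass enters. *)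
Lemma jensen_integral d (T : measurableType d) (mu : {measure set T -> \bar R})
    (w h : T -> R) (q M : R) : 1 <= q -> 0 < M ->
  measurable_fun setT w -> measurable_fun setT h ->
  (forall t, 0 <= w t) -> (forall t, 0 <= h t) ->
  (\int[mu]_t (w t)%:E <= M%:E)%E ->
  ((\int[mu]_t (w t * h t)%:E) `^ q <=
    (M `^ (q - 1))%:E * \int[mu]_t (w t * h t `^ q)%:E)%E.
Proof.
move=> q1 M0 mw mh w0 h0 wM; have q0 : 0 < q by exact: lt_le_trans q1.
have qi : 0 <= 1 - q^-1 by rewrite subr_ge0 invf_le1.
have mhq : measurable_fun setT (fun t => h t `^ q) by exact: (measurableT_comp (measurable_powR
    q) mh).
have mwhq : measurable_fun setT (fun t => (w t * h t `^ q)%:E).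
  by apply/measurable_EFinP; exact: measurable_funM.
have mwh : measurable_fun setT (fun t => (w t * h t)%:E).
  by apply/measurable_EFinP; exact: measurable_funM.
have mwE : measurable_fun setT (fun t => (w t)%:E) by exact/measurable_EFinP.
have whq0 t : (0 <= (w t * h t `^ q)%:E)%E by rewrite lee_fin mulr_ge0 ?powR_ge0.
have wE0 t : (0 <= (w t)%:E)%E by rewrite lee_fin.
have H0 : (0 <= \int[mu]_t (w t * h t `^ q)%:E)%E by exact: integral_ge0.
have [Hfin|] := boolP ((\int[mu]_t (w t * h t `^ q)%:E)%E \is a fin_num); last first.
  rewrite ge0_fin_numE // ltey negbK => /eqP ->.
  by rewrite gt0_muley ?leey // lte_fin powR_gt0.
have [H HE] : exists H, (\int[mu]_t (w t * h t `^ q)%:E = H%:E)%E.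
  by exists (fine (\int[mu]_t (w t * h t `^ q)%:E)); rewrite fineK.
rewrite HE in H0 *; rewrite lee_fin in H0.
apply/lee_addgt0Pr => e e0.
have Mq : 0 < M `^ (q - 1) by rewrite powR_gt0.
(* The surplus makes [s] positive even for [H = 0] and costs exactly [e] in the end, because
   [(s M)^q = M^(q-1) H']. The value [s = (H' / M)^(1/q)] makes the two integrated terms add up to
   [s M]. *)
pose H' := H + e / M `^ (q - 1).
have H'0 : 0 < H' by rewrite ltr_wpDl // divr_gt0.
pose s := (H' / M) `^ q^-1.
have s0 : 0 < s by rewrite powR_gt0 // divr_gt0.
have sq : s `^ q = H' / M by rewrite -powRrM mulVf ?gt_eqF // powRr1 // divr_ge0 // ltW.
have c0 : 0 <= s `^ (1 - q) / q by rewrite divr_ge0 ?powR_ge0 ?ltW.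
have c1 : 0 <= (1 - q^-1) * s by rewrite mulr_ge0 // ltW.
have G : (\int[mu]_t (w t * h t)%:E <= (s * M)%:E)%E.
  apply: (@le_trans _ _ (\int[mu]_t ((s `^ (1 - q) / q)%:E * (w t * h t `^ q)%:E +
      ((1 - q^-1) * s)%:E * (w t)%:E))%E).
    apply: ge0_le_integral => //.
    - by move=> t _; rewrite lee_fin mulr_ge0.
    - by apply: emeasurable_funD; apply: measurable_funeM.
    - move=> t _; rewrite -!EFinM -EFinD lee_fin.
      rewrite (mulrCA _ (w t)) (mulrC _ (w t)) -mulrDr.
      by rewrite ler_wpM2l // young_powR.
  rewrite ge0_integralD //; last 4 first.
  - by move=> t _; rewrite mule_ge0 // lee_fin.
  - exact: measurable_funeM.
  - by move=> t _; rewrite mule_ge0 // lee_fin.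
  - exact: measurable_funeM.
  rewrite !ge0_integralZl ?lee_fin //.
  apply: (@le_trans _ _ ((s `^ (1 - q) / q * H')%:E + ((1 - q^-1) * s * M)%:E)%E).
    apply: leeD.
      by rewrite HE -EFinM lee_fin ler_wpM2l // lerDl divr_ge0 // ltW.
    by rewrite [in leRHS]EFinM lee_wpmul2l ?lee_fin.
  rewrite -EFinD lee_fin.
  have -> : s `^ (1 - q) / q * H' = s * M / q.
    rewrite powRB; last by apply/implyP => _; rewrite gt_eqF.
    rewrite powRr1 ?ltW // sq invf_div; field.
    by rewrite !gt_eqF.
  rewrite le_eqVlt; apply/orP; left; apply/eqP; field.
  by rewrite gt_eqF.
have G0 : (0 <= \int[mu]_t (w t * h t)%:E)%E.
  by apply: integral_ge0 => t _; rewrite lee_fin mulr_ge0.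
apply: (@le_trans _ _ ((s * M)%:E `^ q)%E).
  by apply: gt0_ler_poweR => //; rewrite ?ltW // in_itv /= ?G0 ?leey // lee_fin mulr_ge0 ?ltW.
rewrite poweR_EFin -EFinM -EFinD lee_fin (powRM _ (ltW s0) (ltW M0)) sq.
rewrite powRB; last by apply/implyP => _; rewrite gt_eqF.
rewrite (powRr1 (ltW M0)) le_eqVlt; apply/orP; left; apply/eqP.
rewrite /H' powRB; last by apply/implyP => _; rewrite gt_eqF.
rewrite (powRr1 (ltW M0)); field.
by rewrite !gt_eqF // powR_gt0.
Qed.

(** The bound is a polynomial in [e], hence continuous at 0. *)
Lemma le_prod_shift (m : nat) (D c : R) (N : 'I_m -> R) (X : \bar R) :
  (forall e, 0 < e -> (X <= (D * (c + e) * \prod_i (N i + e))%:E)%E) ->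
  (X <= (D * c * \prod_i N i)%:E)%E.
Proof.
move=> h; pose f := D *: (c%:P + 'X) * \prod_i ((N i)%:P + 'X).
have fE e : f.[e] = D * (c + e) * \prod_i (N i + e).
  rewrite /f hornerM hornerZ horner_prod !hornerE; congr (_ * _).
  by apply: eq_bigr => i _; rewrite !hornerE.
have f0 : f.[0] = D * c * \prod_i N i.
  by rewrite fE addr0; congr (_ * _); apply: eq_bigr => i _; rewrite addr0.
rewrite leNgt; apply/negP; rewrite -f0 => fX.
(* [X] may be infinite; a real [x] between [f(0)] and [X] reduces the limit to real numbers. *)
have [x [fx xX]] : exists x, f.[0] < x /\ (x%:E <= X)%E.
  case: X fX {h} => [x| |//] fX; first by exists x; split; rewrite -?lte_fin.
  by exists (f.[0] + 1); rewrite ltrDl ltr01 leey.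
have : \forall e \near (0 : R)^'+, 0 < e /\ f.[e] < x.
  near=> e; split; first by near: e; exact: nbhs_right_gt.
  near: e; apply: cvgr_lt fx; apply: cvg_at_right_filter.
  exact: continuous_horner.
move=> /filter_ex[e [e0 fe]].
have := le_trans xX (h e e0); rewrite -fE lee_fin => /(lt_le_trans fe).
by rewrite ltxx.
Unshelve. all: by end_near. Qed.
End inequalities.

(** * Central Morrey norms *)

Section morrey.
Context {p : nat} {R : realType} {K : fieldType} {abs : K -> R}.
Context (hp : prime p) (hK : is_Qp_model p abs).
Local Notation P := (p%:R : R).
Let P1 : 1 < P. Proof. exact: Qp_base_gt1. Qed.
Let P0 : 0 < P. Proof. exact: Qp_base_gt0. Qed.
Context {n : nat} (n0 : (0 < n)%N).
Local Notation V := (Qpn abs p n).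
Local Notation vn := (vnorm abs).
Local Notation mn := (mnorm abs).
Local Notation B := (@Bball R K abs p n).
Context (mu : {measure set V -> \bar R}) (haar_mu : is_haar abs mu).

Lemma haar_tonelli (f : V * V -> \bar R) : measurable_fun setT f -> (forall z, 0 <= f z)%E ->
  (\int[mu]_x \int[mu]_y f (x, y) = \int[mu]_y \int[mu]_x f (x, y))%E.
Proof.
move=> mf f0; have sf := haar_sigma_finite hp hK haar_mu.
(* [mu] is given as a bare measure; its sigma-finiteness is packed into the structure that
   Fubini-Tonelli expects. *)
pose H1 := isSFinite.Build _ _ _ _ (sfinite_measure_sigma_finite sf).
pose H2 := isSigmaFinite.Build _ _ _ _ sf.
pose m := HB.pack_for (SigmaFiniteMeasure.type V R) (Measure.sort mu) H1 H2.
exact: (@fubini_tonelli _ _ _ _ _ m m f).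
Qed.

Lemma haar_tonelli_measurable (f : V * V -> \bar R) :
  measurable_fun setT f -> (forall z, 0 <= f z)%E ->
  measurable_fun setT (fun x => (\int[mu]_y f (x, y))%E).
Proof.
move=> mf f0; have sf := haar_sigma_finite hp hK haar_mu.
pose H1 := isSFinite.Build _ _ _ _ (sfinite_measure_sigma_finite sf).
pose H2 := isSigmaFinite.Build _ _ _ _ sf.
pose m := HB.pack_for (SigmaFiniteMeasure.type V R) (Measure.sort mu) H1 H2.
exact: (@measurable_fun_fubini_tonelli_F _ _ _ _ _ m f).
Qed.

Lemma ae_neq0 : {ae mu, forall x : V, (x : 'cV[K]_n) != 0}.
Proof.
exists [set (0 : 'cV[K]_n) : V]; split.
- exact: measurable_set0cV.
- exact: haar_set0.
- by move=> x /= /negP; rewrite negbK => /eqP.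
Qed.

(** The laws of powers fail for [|x|^a] at the origin, where 0 to the power 0 is 1 and all other
    powers are 0; pointwise comparisons are therefore made only off this null point. *)
Lemma le_integral_neq0 (D : set V) (f g : V -> \bar R) : measurable D ->
  measurable_fun setT f -> measurable_fun setT g ->
  (forall x, 0 <= f x)%E -> (forall x, 0 <= g x)%E ->
  (forall x, D x -> (x : 'cV[K]_n) != 0 -> (f x <= g x)%E) ->
  (\int[mu]_(x in D) f x <= \int[mu]_(x in D) g x)%E.
Proof.
move=> mD mf mg f0 g0 h; apply: ae_ge0_le_integral => //.
- exact: measurable_funTS.
- exact: measurable_funTS.
- by apply: filterS ae_neq0 => x x0 Dx; exact: h.
Qed.

Lemma eq_integral_neq0 (D : set V) (f g : V -> \bar R) : measurable D ->
  measurable_fun setT f -> measurable_fun setT g ->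
  (forall x, 0 <= f x)%E -> (forall x, 0 <= g x)%E ->
  (forall x, D x -> (x : 'cV[K]_n) != 0 -> f x = g x) ->
  (\int[mu]_(x in D) f x = \int[mu]_(x in D) g x)%E.
Proof.
move=> mD mf mg f0 g0 h; apply/eqP; rewrite eq_le; apply/andP; split;
  by apply: le_integral_neq0 => // x Dx x0; rewrite h.
Qed.

Definition wmass a := fine (wball mu a 0).

Lemma wmass_gt0 a : - n%:R < a -> 0 < wmass a.
Proof.
move=> an; apply: fine_gt0; rewrite (wball0_gt0 hp hK n0 haar_mu).
exact: (wball0_lty hp hK n0 haar_mu an).
Qed.

Lemma wballE (a : R) g : - n%:R < a ->
  wball mu a g = (P `^ (g%:~R * (a + n%:R)) * wmass a)%:E.
Proof.
move=> an; rewrite (wball_scale hp hK n0 haar_mu) EFinM fineK //.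
by rewrite ge0_fin_numE ?(wball0_lty hp hK n0 haar_mu an) // ltW // (wball0_gt0 hp hK n0 haar_mu).
Qed.

Lemma wpowD a b (x : 'cV[K]_n) : x != 0 -> wpow abs (a + b) x = wpow abs a x * wpow abs b x.
Proof.
move=> x0; apply: powRD; apply/implyP => _.
by rewrite gt_eqF // (vnorm_gt0 hK).
Qed.

Lemma measurable_wpowE (a : R) : measurable_fun setT (fun x : V => (wpow abs a (x : 'cV[K]_n))%:E).
Proof. by apply/measurable_EFinP; exact: (measurable_wpow hp hK). Qed.

Lemma integral_wpow_wpow q a b g : 
  (\int[mu]_(x in B g) (`|wpow abs b (x : 'cV[K]_n)| `^ q * wpow abs a (x : 'cV[K]_n))%:E
   = wball mu (b * q + a) g)%E.
Proof.
apply: eq_integral_neq0; first exact: measurable_Bball.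
- apply/measurable_EFinP; apply: measurable_funM; last exact: (measurable_wpow hp hK).
  apply: (measurableT_comp (measurable_powR q)).
  apply: measurableT_comp; first exact: normr_measurable.
  exact: (measurable_wpow hp hK).
- exact: measurable_wpowE.
- by move=> x; rewrite lee_fin mulr_ge0 ?powR_ge0 // wpow_ge0.
- by move=> x; rewrite lee_fin wpow_ge0.
move=> x _ x0; rewrite (ger0_norm (wpow_ge0 _ _)) wpowD //; congr (_ * _)%:E.
by rewrite /wpow -powRrM.
Qed.

(** For the exponent [(a + n) lam] every ball gives the same term in the supremum defining the
    Morrey norm; this is the common value. *)
Definition wpow_norm q lam a :=
  ((wmass a) `^ (- 1 - lam * q) * wmass ((a + n%:R) * lam * q + a)) `^ q^-1.

(** Local integrability of the extremal power: adding [n] to the exponent leaves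
    [(a + n) (1 + lam q)], which is positive because [lam > -1/q]. *)
Lemma wpow_norm_exponent (q lam a : R) : 0 < q -> - n%:R < a -> - q^-1 < lam ->
  - n%:R < (a + n%:R) * lam * q + a.
Proof.
move=> q0 an ql; have an' : 0 < a + n%:R by rewrite -ltrBlDr sub0r.
have h : 0 < 1 + lam * q by rewrite -ltrBlDl sub0r -ltr_pdivrMr // mulN1r.
rewrite -subr_gt0 opprK.
have -> : (a + n%:R) * lam * q + a + n%:R = (a + n%:R) * (1 + lam * q) by ring.
exact: mulr_gt0.
Qed.

Lemma wpow_norm_gt0 (q lam a : R) : 0 < q -> - n%:R < a -> - q^-1 < lam -> 0 < wpow_norm q lam a.
Proof.
move=> q0 an ql; rewrite powR_gt0 // mulr_gt0 ?powR_gt0 ?wmass_gt0 //.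
exact: wpow_norm_exponent.
Qed.

Lemma wball_powR (a : R) g t : - n%:R < a ->
  fine (wball mu a g) `^ t = P `^ (g%:~R * ((a + n%:R) * t)) * wmass a `^ t.
Proof.
move=> an; rewrite wballE //= powRM ?powR_ge0 ?(ltW (wmass_gt0 an)) //.
by rewrite -powRrM mulrA.
Qed.

Lemma morrey_norm_wpow (q lam a : R) : 0 < q -> - n%:R < a -> - q^-1 < lam ->
  morrey_norm mu q lam a (fun x : V => (wpow abs ((a + n%:R) * lam) (x : 'cV[K]_n))%:E) =
  (wpow_norm q lam a)%:E.
Proof.
move=> q0 an ql; have bn := wpow_norm_exponent q0 an ql.
rewrite /morrey_norm; set F := (fun g : int => _).
have FE g : F g = (wpow_norm q lam a)%:E.
  (* Extended-real norms and powers of a finite value compute to the real ones, so the two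
     integrands are convertible. *)
  rewrite /F -[X in (_ * X)%E]/((\int[mu]_(x in B g) (`|wpow abs ((a + n%:R) * lam) (x :
      'cV[K]_n)| `^ q * wpow abs a (x : 'cV[K]_n))%:E)%E).
  rewrite integral_wpow_wpow wball_powR // wballE // -EFinM poweR_EFin /wpow_norm; congr (_ `^
      _)%:E.
  rewrite mulrACA -powRD; last by apply/implyP => _; rewrite gt_eqF.
  rewrite (_ : _ + _ = 0); first by rewrite powRr0 mul1r.
  by ring.
rewrite (_ : range F = [set (wpow_norm q lam a)%:E]) ?ereal_sup1 //.
apply/seteqP; split => [_ [g _ <-]|_ ->]; first by rewrite FE.
by exists 0 => //; rewrite FE.
Qed.

Lemma wpow_in_morrey (q lam a : R) : 0 < q -> - n%:R < a -> - q^-1 < lam ->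
  in_morrey mu q lam a (fun x : V => wpow abs ((a + n%:R) * lam) (x : 'cV[K]_n)).
Proof.
move=> q0 an ql; split; first exact: (measurable_wpow hp hK).
  move=> g; rewrite integral_wpow_wpow wballE ?ltry //.
  exact: wpow_norm_exponent.
by rewrite morrey_norm_wpow // ltry.
Qed.

Lemma morrey_norm_ge0 q lam a F : (0 <= morrey_norm mu q lam a F)%E.
Proof.
apply: (@le_trans _ _ ((((fine (wball mu a 0)) `^ (- 1 - lam * q))%:E *
      \int[mu]_(x in B 0) ((`|F x| `^ q) * (wpow abs a (x : 'cV[K]_n))%:E)) `^ q^-1)%E).
  exact: poweR_ge0.
by apply: ereal_sup_ubound; exists 0.
Qed.

(* Testing only the unit ball already bounds the norm of [k |x|^((a+n) lam)] from below. *)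
Lemma morrey_norm_ge (q lam a : R) (F : V -> \bar R) (k : \bar R) :
  0 < q -> - n%:R < a -> - q^-1 < lam -> (0 <= k)%E -> measurable_fun setT F ->
  (forall x : V, (x : 'cV[K]_n) != 0 ->
     (k * (wpow abs ((a + n%:R) * lam) (x : 'cV[K]_n))%:E <= `|F x|)%E) ->
  (k * (wpow_norm q lam a)%:E <= morrey_norm mu q lam a F)%E.
Proof.
move=> q0 an ql k0 mF kF; set b := (a + n%:R) * lam in kF *.
have w0 c (x : V) : (0 <= (wpow abs c (x : 'cV[K]_n))%:E)%E by rewrite lee_fin wpow_ge0.
have mabsF : measurable_fun setT (fun x => (`|F x| `^ q * (wpow abs a (x : 'cV[K]_n))%:E)%E).
  apply: emeasurable_funM; last exact: measurable_wpowE.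
  apply: (measurableT_comp (measurable_poweR q)).
  exact: measurableT_comp.
apply: (@le_trans _ _ ((((fine (wball mu a 0)) `^ (- 1 - lam * q))%:E *
      \int[mu]_(x in B 0) ((`|F x| `^ q) * (wpow abs a (x : 'cV[K]_n))%:E)) `^ q^-1)%E); last first.
  by apply: ereal_sup_ubound; exists 0.
(* The power of [k] is extended-real, since [k] is allowed to be [+oo]. *)
have h : (k `^ q * wball mu (b * q + a) 0 <=
    \int[mu]_(x in B 0) ((`|F x| `^ q) * (wpow abs a (x : 'cV[K]_n))%:E))%E.
  rewrite /wball -ge0_integralZl ?poweR_ge0 //; last 2 first.
  - exact: measurable_Bball.
  - by apply: measurable_funTS; exact: measurable_wpowE.
  apply: le_integral_neq0 => //.
  - exact: measurable_Bball.
  - by apply: measurable_funeM; exact: measurable_wpowE.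
  - by move=> x; rewrite mule_ge0 ?poweR_ge0.
  - by move=> x; rewrite mule_ge0 ?poweR_ge0.
  move=> x _ x0; rewrite wpowD // EFinM muleA; apply: lee_wpmul2r => //.
  have -> : (wpow abs (b * q) (x : 'cV[K]_n))%:E = ((wpow abs b (x : 'cV[K]_n))%:E `^ q)%E.
    by rewrite poweR_EFin /wpow -powRrM.
  rewrite -poweRM //; apply: gt0_ler_poweR; rewrite ?(ltW q0) //; last exact: kF.
  - by rewrite in_itv /= leey andbT mule_ge0.
  - by rewrite in_itv /= leey andbT abse_ge0.
apply: (@le_trans _ _ (((fine (wball mu a 0) `^ (-1 - lam * q))%:E * (k `^ q * wball mu (b * q +
    a) 0)) `^ q^-1)%E); last first.
  apply: gt0_ler_poweR; first by rewrite invr_ge0 ltW.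
  - by rewrite in_itv /= leey andbT !mule_ge0 ?poweR_ge0 ?lee_fin ?powR_ge0 // integral_ge0.
  - rewrite in_itv /= leey andbT mule_ge0 ?lee_fin ?powR_ge0 // integral_ge0 // => x _.
    by rewrite mule_ge0 ?poweR_ge0.
  by rewrite lee_wpmul2l // lee_fin powR_ge0.
have bn := wpow_norm_exponent q0 an ql.
rewrite (wballE 0 bn) mul0r powRr0 mul1r muleCA -EFinM poweRM ?poweR_ge0 //; last first.
  by rewrite lee_fin mulr_ge0 ?powR_ge0 // ltW // wmass_gt0.
by rewrite -poweRrM mulfV ?gt_eqF // poweRe1.
Qed.

End morrey.

(** * The operator and its dilations *)

Section operator.
Context {p : nat} {R : realType} {K : fieldType} {abs : K -> R}.
Context (hp : prime p) (hK : is_Qp_model p abs).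
Local Notation P := (p%:R : R).
Let P1 : 1 < P. Proof. exact: Qp_base_gt1. Qed.
Let P0 : 0 < P. Proof. exact: Qp_base_gt0. Qed.
Context {n : nat} (n0 : (0 < n)%N).
Local Notation V := (Qpn abs p n).
Local Notation vn := (vnorm abs).
Local Notation mn := (mnorm abs).
Local Notation B := (@Bball R K abs p n).
Context (mu : {measure set V -> \bar R}) (haar_mu : is_haar abs mu).

Lemma vnorm_mulmx_ge (A : 'M[K]_n) (x : 'cV[K]_n) : A \in unitmx ->
  vn x <= mn (invmx A) * vn (A *m x).
Proof. by move=> uA; rewrite -{1}(mulKmx uA x) (vnorm_mulmx hK). Qed.

Context {m : nat} (Phi : V -> R) (A : 'I_m -> V -> 'M[K]_n).
Context (Phi0 : forall y, 0 <= Phi y) (mPhi : measurable_fun setT Phi)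
  (mA : forall i, meas_mx abs (A i)).

Lemma kernel_ge0 (y : V) : 0 <= Phi y / (vn (y : 'cV[K]_n) ^+ n).
Proof. by rewrite divr_ge0 // exprn_ge0 // (vnorm_ge0 hK). Qed.

Lemma measurable_kernel : measurable_fun setT (fun y : V => Phi y / (vn (y : 'cV[K]_n) ^+ n)).
Proof.
apply: measurable_funM => //.
rewrite (_ : (fun y : V => _) = (fun y : V => vn (y : 'cV[K]_n) `^ (- n%:R))).
  exact: (measurableT_comp (measurable_powR _) (measurable_vnorm hp hK)).
by apply/funext => y; rewrite powR_invn ?(vnorm_ge0 hK).
Qed.

Lemma measurable_mxinv_powR i t : measurable_fun setT (fun y : V => mn (invmx (A i y)) `^ t).
Proof.
exact: (measurableT_comp (measurable_powR t) (measurable_fun_mnorm_inv hp hK (mA i))).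
Qed.

Lemma measurable_action i : measurable_fun setT (fun xy : V * V => (A i xy.2 *m (xy.1 :
    'cV[K]_n)) : V).
Proof.
apply: (measurable_fun_mulmx hp hK (A := fun xy : V * V => A i xy.2) (x := fst)); last exact:
    measurable_fst.
move=> j k a r.
have := @measurable_snd _ _ V V measurableT _ (mA i j k a r).
by rewrite setTI.
Qed.

Lemma measurable_Hop_integrand (fs : 'I_m -> V -> R) : (forall i, measurable_fun setT (fs i)) ->
  measurable_fun setT (fun xy : V * V => (Phi xy.2 / (vn (xy.2 : 'cV[K]_n) ^+ n)) *
     \prod_(i < m) fs i (A i xy.2 *m (xy.1 : 'cV[K]_n))).
Proof.
move=> mfs; apply: measurable_funM.
  exact: (measurableT_comp measurable_kernel measurable_snd).
apply: measurable_prod => i _.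
exact: (measurableT_comp (mfs i) (measurable_action i)).
Qed.

Lemma measurable_Hop (fs : 'I_m -> V -> R) : (forall i, measurable_fun setT (fs i)) ->
  measurable_fun setT (Hop mu m Phi A fs).
Proof.
move=> mfs; have mF := measurable_Hop_integrand mfs.
set F := (fun xy : V * V => _) in mF.
have mE : measurable_fun setT (EFin \o F) by exact/measurable_EFinP.
(* The [fs i] may change sign; the positive and negative parts are handled separately, since Tonelli
   gives measurability only for nonnegative integrands. *)
rewrite (_ : Hop _ _ _ _ _ = fun x => ((\int[mu]_y (EFin \o F)^\+ (x, y)) -
    (\int[mu]_y (EFin \o F)^\- (x, y)))%E); last first.
  apply/funext => x; rewrite /Hop [LHS]integralE; congr (_ - _)%E; apply: eq_integral => y _;
    by rewrite ?funeposE ?funenegE.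
apply: emeasurable_funB.
- have h := @haar_tonelli_measurable p R K abs hp hK n mu haar_mu _ (measurable_funepos mE).
  by apply: h => z; exact: funepos_ge0.
- have h := @haar_tonelli_measurable p R K abs hp hK n mu haar_mu _ (measurable_funeneg mE).
  by apply: h => z; exact: funeneg_ge0.
Qed.

Context (nu : nat).
Context (uA : forall i, {ae mu, forall y, A i y \in unitmx}).
Context (dkA : forall i, {ae mu, forall y, mn (A i y) * mn (invmx (A i y)) <= P ^+ nu}).

Lemma ae_unitmx_DK1 : {ae mu, forall y, forall i,
  A i y \in unitmx /\ mn (A i y) * mn (invmx (A i y)) <= P ^+ nu}.
Proof.
have F := ae_filter_ringOfSetsType mu.
apply: (@filter_forall _ _ (fun i y => A i y \in unitmx /\ mn (A i y) * mn (invmx (A i y)) <= P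
    ^+ nu)) => i.
by apply: filterS2 (uA i) (dkA i) => y; split.
Qed.

(** With [b i = (alphas i + n) * lams i] this is the integrand of [C3], and the density of the
    measure used in Jensen's inequality. *)
Definition weight (b : 'I_m -> R) (y : V) := (Phi y / (vn (y : 'cV[K]_n) ^+ n)) *
  \prod_(i < m) mn (invmx (A i y)) `^ (- b i).

Lemma weight_ge0 b y : 0 <= weight b y.
Proof. by rewrite mulr_ge0 ?kernel_ge0 // prodr_ge0 // => i _; rewrite powR_ge0. Qed.

Lemma measurable_weight b : measurable_fun setT (weight b).
Proof.
apply: measurable_funM; first exact: measurable_kernel.
by apply: measurable_prod => i _; exact: measurable_mxinv_powR.
Qed.

Lemma sum_wpow (b : 'I_m -> R) (x : 'cV[K]_n) : x != 0 ->
  \prod_(i < m) wpow abs (b i) x = wpow abs (\sum_(i < m) b i) x.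
Proof.
move=> x0; elim/big_rec2: _ => [|i u v _ ->]; first by rewrite /wpow powRr0.
by rewrite (wpowD hK).
Qed.

(* [|A x| <= |A| |x| <= p^nu |A^-1|^-1 |x|], raised to a negative power. *)
Lemma wpow_mulmx_ge (M : 'M[K]_n) (x : 'cV[K]_n) b : M \in unitmx -> x != 0 -> b <= 0 ->
  mn M * mn (invmx M) <= P ^+ nu ->
  P `^ (nu%:R * b) * mn (invmx M) `^ (- b) * wpow abs b x <= wpow abs b (M *m x).
Proof.
move=> uM x0 b0 dk; have i0 := mnorm_invmx_gt0 hK n0 uM.
have vx : 0 < vn x by rewrite (vnorm_gt0 hK).
have Mx : 0 < vn (M *m x).
  have := lt_le_trans vx (vnorm_mulmx_ge x uM); rewrite pmulr_rgt0 //.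
have h : vn (M *m x) <= P ^+ nu / mn (invmx M) * vn x.
  apply: (le_trans (vnorm_mulmx hK _ _)); rewrite ler_wpM2r ?(ltW vx) //.
  by rewrite ler_pdivlMr.
have -> : P `^ (nu%:R * b) * mn (invmx M) `^ (- b) * wpow abs b x =
    (P ^+ nu / mn (invmx M) * vn x) `^ b.
  rewrite /wpow powRM ?(ltW vx) //; last by rewrite divr_ge0 ?exprn_ge0 ?ltW.
  rewrite powRM ?exprn_ge0 ?invr_ge0 ?(ltW P0) ?(ltW i0) //.
  by rewrite -(powR_mulrn nu (ltW P0)) -powRrM -(powR_inv1 (ltW i0)) -[in RHS]powRrM mulN1r.
rewrite /wpow -[b]opprK !(powRN _ (- b)) lef_pV2 ?posrE ?powR_gt0 ?mulr_gt0 ?invr_gt0 ?exprn_gt0 //.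
by apply: ge0_ler_powR; rewrite ?oppr_ge0 // nnegrE ?(ltW Mx) // mulr_ge0 ?divr_ge0 ?exprn_ge0 ?ltW.
Qed.

Lemma Hop_wpow_ge (b : 'I_m -> R) (x : V) : (forall i, b i <= 0) -> (x : 'cV[K]_n) != 0 ->
  ((P `^ (nu%:R * \sum_(i < m) b i))%:E * (\int[mu]_y (weight b y)%:E) *
     (wpow abs (\sum_(i < m) b i) (x : 'cV[K]_n))%:E <=
   `|Hop mu m Phi A (fun i (z : V) => wpow abs (b i) (z : 'cV[K]_n)) x|)%E.
Proof.
move=> b0 x0; have mfs i : measurable_fun setT (fun z : V => wpow abs (b i) (z : 'cV[K]_n)).
  exact: (measurable_wpow hp hK).
have F0 (y : V) : (0 <= (Phi y / (vn (y : 'cV[K]_n) ^+ n) *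
     \prod_(i < m) wpow abs (b i) (A i y *m (x : 'cV[K]_n)))%:E)%E.
  by rewrite lee_fin mulr_ge0 ?kernel_ge0 // prodr_ge0 // => i _; exact: wpow_ge0.
rewrite gee0_abs; last by apply: integral_ge0 => y _; exact: F0.
have mw : measurable_fun setT (fun y => (weight b y)%:E).
  by apply/measurable_EFinP; exact: measurable_weight.
have c0 : 0 <= P `^ (nu%:R * \sum_(i < m) b i) * wpow abs (\sum_(i < m) b i) (x : 'cV[K]_n).
  by rewrite mulr_ge0 ?powR_ge0.
rewrite muleAC -EFinM -ge0_integralZl //; last by move=> y _; rewrite lee_fin weight_ge0.
apply: ae_ge0_le_integral => //.
- by move=> y _; rewrite mule_ge0 ?lee_fin ?weight_ge0.
- exact: measurable_funeM.
- apply/measurable_EFinP.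
  exact: (measurableT_comp (measurable_Hop_integrand mfs) (pair1_measurable x)).
apply: filterS ae_unitmx_DK1 => y good _; rewrite -EFinM lee_fin /weight mulrCA ler_wpM2l
    ?kernel_ge0 //.
rewrite -sum_wpow // mulr_sumr.
rewrite (_ : P `^ _ = \prod_(i < m) P `^ (nu%:R * b i)); last first.
  elim/big_rec2: _ => [|i u v _ <-]; first by rewrite powRr0.
  by rewrite powRD //; apply/implyP => _; rewrite gt_eqF.
rewrite -!big_split /=; apply: ler_prod => i _.
rewrite !mulr_ge0 ?powR_ge0 //=; have [u dk] := good i.
by rewrite mulrAC wpow_mulmx_ge.
Qed.

(** For [a >= 0] this is [|x| <= |M^-1| |M x|], the factor [p^(nu |a|)] being slack; for [a <= 0] it
    is [wpow_mulmx_ge] solved for [|x|^a], where (DK1) does enter. *)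
Lemma wpow_mulmx_le (M : 'M[K]_n) (x : 'cV[K]_n) a : M \in unitmx -> x != 0 ->
  mn M * mn (invmx M) <= P ^+ nu ->
  wpow abs a x <= P `^ (nu%:R * `|a|) * mn (invmx M) `^ a * wpow abs a (M *m x).
Proof.
move=> uM x0 dk; have i0 := mnorm_invmx_gt0 hK n0 uM.
have [a0|/ltW a0] := leP 0 a.
  rewrite -mulrA -{1}[wpow abs a x]mul1r; apply: ler_pM; rewrite ?wpow_ge0 //.
    have h0 : 0 <= nu%:R * `|a| by exact: mulr_ge0.
    by have := ler_powR (ltW P1) h0; rewrite powRr0.
  rewrite /wpow -powRM ?(ltW i0) ?(vnorm_ge0 hK) //.
  by apply: ge0_ler_powR; rewrite // ?nnegrE ?mulr_ge0 ?(ltW i0) ?(vnorm_ge0 hK) ?vnorm_mulmx_ge.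
have := wpow_mulmx_ge uM x0 a0 dk.
rewrite ler0_norm // mulrN !powRN -[_ / _]invf_div -ler_pdivlMl; last first.
  by rewrite invr_gt0 divr_gt0 ?powR_gt0.
by rewrite invrK (mulrC (mn (invmx M) `^ a)).
Qed.

Lemma morrey_integral_le q lam a (f : V -> R) g : 0 < q -> - n%:R < a ->
  in_morrey mu q lam a f ->
  (\int[mu]_(x in B g) (`|f x| `^ q * wpow abs a (x : 'cV[K]_n))%:E <=
   ((fine (morrey_norm mu q lam a (fun x => (f x)%:E))) `^ q *
    (fine (wball mu a g)) `^ (1 + lam * q))%:E)%E.
Proof.
move=> q0 an [mf fint fn].
have I0 : (0 <= \int[mu]_(x in B g) (`|f x| `^ q * wpow abs a (x : 'cV[K]_n))%:E)%E.
  by apply: integral_ge0 => x _; rewrite lee_fin mulr_ge0 ?powR_ge0.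
have [r rE] : exists r, (\int[mu]_(x in B g) (`|f x| `^ q * wpow abs a (x : 'cV[K]_n))%:E = r%:E)%E.
  by exists (fine (\int[mu]_(x in B g) (`|f x| `^ q * wpow abs a (x : 'cV[K]_n))%:E)); rewrite
      fineK // ge0_fin_numE.
rewrite rE lee_fin; rewrite rE lee_fin in I0.
set N := fine _; have v0 : 0 < fine (wball mu a g).
  by rewrite (wballE hp hK n0 haar_mu) //= mulr_gt0 ?powR_gt0 ?(wmass_gt0 hp hK n0 haar_mu).
set v := fine _ in v0 *.
have NE : morrey_norm mu q lam a (fun x => (f x)%:E) = N%:E.
  by rewrite fineK // ge0_fin_numE // (morrey_norm_ge0).
have vr0 : 0 <= v `^ (- 1 - lam * q) * r by rewrite mulr_ge0 ?powR_ge0.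
have : (((v `^ (- 1 - lam * q) * r) `^ q^-1)%:E <= N%:E)%E.
  rewrite -NE; apply: ereal_sup_ubound; exists g => //.
  by rewrite -[X in (_ * X)%E]/(\int[mu]_(x in B g) (`|f x| `^ q * wpow abs a (x :
      'cV[K]_n))%:E)%E rE.
rewrite lee_fin => h.
have {}h : v `^ (- 1 - lam * q) * r <= N `^ q.
  have -> : v `^ (- 1 - lam * q) * r = ((v `^ (- 1 - lam * q) * r) `^ q^-1) `^ q.
    by rewrite -powRrM mulVf ?gt_eqF // powRr1.
  have N0 : 0 <= N by apply: le_trans h; exact: powR_ge0.
  by apply: ge0_ler_powR => //; [exact: ltW|rewrite nnegrE powR_ge0].
have -> : v `^ (1 + lam * q) = (v `^ (- 1 - lam * q))^-1 by rewrite -powRN opprD !opprK.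
by rewrite ler_pdivlMr ?powR_gt0 // mulrC.
Qed.

(** The three factors come from moving the weight from [x] to [M x], from the weighted mass of the
    unit ball, and from the enlargement of the ball by [|M| <= p^nu / |M^-1|]. *)
Definition dilation_const (q lam a : R) := P `^ (nu%:R * `|a|) *
  wmass mu a `^ (1 + lam * q) * P `^ (nu%:R * ((a + n%:R) * (1 + lam * q))).

Lemma dilation_const_gt0 q lam a : - n%:R < a -> 0 < dilation_const q lam a.
Proof. by move=> an; rewrite !mulr_gt0 ?powR_gt0 // (wmass_gt0 hp hK n0 haar_mu). Qed.

(** The bound depends on [M] only through [nu]: the powers of [|M^-1|] from the normalization, the
    weight and the Jacobian multiply to [|M^-1|^s], and the enlarged ball costs [|M|^s]. *)
Lemma integral_dilation_le q lam a (f : V -> R) g (M : 'M[K]_n) :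
  0 < q -> - n%:R < a -> - q^-1 < lam -> in_morrey mu q lam a f ->
  M \in unitmx -> mn M * mn (invmx M) <= P ^+ nu ->
  (\int[mu]_(x in B g) ((`|f (M *m (x : 'cV[K]_n))| * mn (invmx M) `^ ((a + n%:R) * lam)) `^ q *
      wpow abs a (x : 'cV[K]_n))%:E <=
   (dilation_const q lam a * (fine (morrey_norm mu q lam a (fun x => (f x)%:E))) `^ q *
     P `^ (g%:~R * ((a + n%:R) * (1 + lam * q))))%:E)%E.
Proof.
move=> q0 an ql hf uM dk; have b0 := mnorm_invmx_gt0 hK n0 uM.
have mf : measurable_fun setT f by case: hf.
set b := mn (invmx M) in b0 dk *; set N := fine _.
set s := (a + n%:R) * (1 + lam * q).
have s0 : 0 <= s.
  rewrite mulr_ge0 //; first by rewrite ltW // -ltrBlDr sub0r.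
  by rewrite ltW // -ltrBlDl sub0r -ltr_pdivrMr // mulN1r.
have M0 : 0 < mn M by have := mnorm_invmx_gt0 hK n0 (etrans (unitmx_inv M) uM); rewrite invmxK.
have [k kE] := mnorm_valueP hK M0.
have mF : measurable_fun setT (fun z : V => (`|f z| `^ q * wpow abs a (z : 'cV[K]_n))%:E).
  apply/measurable_EFinP; apply: measurable_funM; last exact: (measurable_wpow hp hK).
  apply: (measurableT_comp (measurable_powR q)).
  by apply: (measurableT_comp _ mf); exact: normr_measurable.
(* As [|M| = p^k], [M] maps [B g] into [B (g + k)]. With the cutoff placed on the image side, the
   domain can be enlarged to the whole space before the change of variables. *)
pose G := (fun z : V => (`|f z| `^ q * wpow abs a (z : 'cV[K]_n))%:E) \_ (B (g + k)).
have mG : measurable_fun setT G.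
  apply/(measurable_restrictT _ _).1; first exact: measurable_Bball.
  exact: measurable_funTS.
have G0 z : (0 <= G z)%E.
  by apply: erestrict_ge0 => y _; rewrite lee_fin mulr_ge0 ?powR_ge0.
have mGM : measurable_fun setT (fun x : V => G (M *m (x : 'cV[K]_n))).
  exact: (measurableT_comp mG (measurable_mulmx hp hK M)).
set be := (a + n%:R) * lam.
pose c := b `^ (be * q) * (P `^ (nu%:R * `|a|) * b `^ a).
have c0 : 0 <= c by rewrite !mulr_ge0 ?powR_ge0.
have mfM : measurable_fun setT (fun x : V => f (M *m (x : 'cV[K]_n))).
  exact: (measurableT_comp mf (measurable_mulmx hp hK M)).
apply: (@le_trans _ _ (\int[mu]_(x in B g) (c%:E * G (M *m (x : 'cV[K]_n))))%E).
  apply: (le_integral_neq0 hp hK n0 haar_mu).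
  - exact: measurable_Bball.
  - apply/measurable_EFinP; apply: measurable_funM; last exact: (measurable_wpow hp hK).
    apply: (measurableT_comp (measurable_powR q)); apply: measurable_funM => //.
    by apply: (measurableT_comp _ mfM); exact: normr_measurable.
  - exact: measurable_funeM.
  - by move=> x; rewrite lee_fin mulr_ge0 ?powR_ge0.
  - by move=> x; rewrite mule_ge0.
  move=> x Bx x0; rewrite /G patchE ifT; last first.
    apply/mem_set; rewrite /Bball /=; apply: (le_trans (vnorm_mulmx hK _ _)).
    by rewrite kE expfzDr ?gt_eqF // mulrC ler_wpM2r // exprz_ge0 // ltW.
  rewrite -EFinM lee_fin powRM ?powR_ge0 // -powRrM.
  rewrite -mulrA mulrC /c -!mulrA ler_wpM2l ?powR_ge0 //.
  rewrite [leLHS]mulrC [leRHS](_ : _ = `|f (M *m (x : 'cV[K]_n))| `^ q * (P `^ (nu%:R * `|a|) *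
      b `^ a * wpow abs a (M *m (x : 'cV[K]_n)))); last by ring.
  by rewrite ler_wpM2l ?powR_ge0 // wpow_mulmx_le.
apply: (@le_trans _ _ (\int[mu]_x (c%:E * G (M *m (x : 'cV[K]_n))))%E).
  apply: ge0_subset_integral => //; first exact: measurable_Bball.
    exact: measurable_funeM.
  by move=> x _; rewrite mule_ge0.
rewrite ge0_integralZl //.
rewrite (haar_change_of_variables hp hK n0 haar_mu uM mG G0) -integral_mkcond.
have jb := jacobian_le hp hK n0 haar_mu uM.
apply: (@le_trans _ _ (c%:E * ((b ^+ n)%:E * (N `^ q * (fine (wball mu a (g + k))) `^ (1 + lam *
    q))%:E))%E).
  rewrite lee_wpmul2l ?lee_fin //; apply: lee_pmul => //.
  - by apply: integral_ge0 => x _; rewrite lee_fin mulr_ge0 ?powR_ge0.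
  - exact: morrey_integral_le.
rewrite -!EFinM lee_fin (wball_powR hp hK n0 haar_mu) // -/s intrD mulrDl powRD; last first.
  by apply/implyP => _; rewrite gt_eqF.
(* This is (DK1) raised to the power [s], which is nonnegative because [lam > -1/q]. *)
have ks : P `^ (k%:~R * s) <= P `^ (nu%:R * s) / b `^ s.
  rewrite (powRrM P k%:~R) (powRrM P nu%:R) powR_intmul ?(ltW P0) // -kE powR_mulrn ?(ltW P0) //.
  rewrite ler_pdivlMr ?powR_gt0 // -powRM ?(ltW M0) ?(ltW b0) //.
  by apply: ge0_ler_powR; rewrite // nnegrE ?mulr_ge0 ?exprn_ge0 ?(ltW M0) ?(ltW b0) ?(ltW P0).
have bs : b `^ (be * q) * b `^ a * b ^+ n = b `^ s.
  rewrite -(powR_mulrn n (ltW b0)) -!powRD; last 2 first.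
  - by apply/implyP => _; rewrite gt_eqF.
  - by apply/implyP => _; rewrite gt_eqF.
  by congr (_ `^ _); rewrite /s /be; ring.
rewrite /c /dilation_const -/s.
rewrite [leLHS](_ : _ = (P `^ (nu%:R * `|a|) * wmass mu a `^ (1 + lam * q) * N `^ q * P `^
    (g%:~R * s)) *
   ((b `^ (be * q) * b `^ a * b ^+ n) * P `^ (k%:~R * s))); last by ring.
rewrite [leRHS](_ : _ = (P `^ (nu%:R * `|a|) * wmass mu a `^ (1 + lam * q) * N `^ q * P `^
    (g%:~R * s)) *
   P `^ (nu%:R * s)); last by ring.
rewrite ler_wpM2l ?mulr_ge0 ?powR_ge0 // bs.
by rewrite mulrC -ler_pdivlMr ?powR_gt0.
Qed.

End operator.

(** * Lower and upper bounds *)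

Section bounds.
Context {p : nat} {R : realType} {K : fieldType} {abs : K -> R}.
Context (hp : prime p) (hK : is_Qp_model p abs).
Local Notation P := (p%:R : R).
Let P1 : 1 < P. Proof. exact: Qp_base_gt1. Qed.
Let P0 : 0 < P. Proof. exact: Qp_base_gt0. Qed.
Context {n : nat} (n0 : (0 < n)%N).
Local Notation V := (Qpn abs p n).
Local Notation vn := (vnorm abs).
Local Notation mn := (mnorm abs).
Local Notation B := (@Bball R K abs p n).
Context (mu : {measure set V -> \bar R}) (haar_mu : is_haar abs mu).
Context {m : nat} (m0 : (0 < m)%N) (q : R) (qs : 'I_m -> R) (alpha : R) (alphas : 'I_m -> R)
  (lam : R) (lams : 'I_m -> R) (nu : nat)
  (q1 : 1 <= q) (qs1 : forall i, 1 <= qs i)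
  (halphas : forall i, - (n%:R) < alphas i)
  (hsumq : \sum_(i < m) (qs i)^-1 = q^-1)
  (hsumalpha : \sum_(i < m) alphas i / qs i = alpha / q)
  (hlams : forall i, - (qs i)^-1 < lams i < 0)
  (hlam : (alpha + n%:R) * lam = \sum_(i < m) (alphas i + n%:R) * lams i).

Let q0 : 0 < q. Proof. exact: lt_le_trans q1. Qed.
Let qs0 i : 0 < qs i. Proof. exact: lt_le_trans (qs1 i). Qed.
Let lams_gt i : - (qs i)^-1 < lams i. Proof. by case/andP: (hlams i). Qed.
Let lams_lt i : lams i < 0. Proof. by case/andP: (hlams i). Qed.
Let beta i := (alphas i + n%:R) * lams i.
Let alphan_gt0 i : 0 < alphas i + n%:R. Proof. by rewrite -ltrBlDr sub0r. Qed.
Let beta_le0 i : beta i <= 0.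
Proof. by rewrite /beta mulr_ge0_le0 // ltW. Qed.

Lemma sum_alpha_shift : \sum_(i < m) (alphas i + n%:R) / qs i = (alpha + n%:R) / q.
Proof.
under eq_bigr do rewrite mulrDl.
by rewrite big_split /= hsumalpha -mulr_sumr hsumq -mulrDl.
Qed.

(** [(alpha + n) / q] is a nonempty sum of the positive numbers [(alphas i + n) / qs i]. *)
Lemma alpha_gt : - n%:R < alpha.
Proof.
rewrite -[ltLHS]add0r ltrBlDr -(pmulr_lgt0 _ (_ : 0 < q^-1)) ?invr_gt0 //.
rewrite -sum_alpha_shift (bigD1 (Ordinal m0)) //= ltr_pwDl ?divr_gt0 // sumr_ge0 // => i _.
by rewrite divr_ge0 // ltW.
Qed.

(** [(alpha + n) (lam + 1/q)] is the sum of the positive terms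
    [(alphas i + n) (lams i + 1 / qs i)]. *)
Lemma lam_gt : - q^-1 < lam.
Proof.
have an : 0 < alpha + n%:R by rewrite -ltrBlDr sub0r alpha_gt.
rewrite -(ltr_pM2l an) hlam mulrN -sum_alpha_shift -sumrN.
have h i : 0 < (alphas i + n%:R) * lams i - - ((alphas i + n%:R) / qs i).
  by rewrite -mulrN -mulrBr mulr_gt0 // subr_gt0.
rewrite -subr_gt0 -sumrB (bigD1 (Ordinal m0)) //= ltr_pwDl // sumr_ge0 // => i _.
exact: ltW.
Qed.

Section fixed_kernel.
Context (Phi : V -> R) (A : 'I_m -> V -> 'M[K]_n).
Context (Phi0 : forall y, 0 <= Phi y) (mPhi : measurable_fun setT Phi)
  (mA : forall i, meas_mx abs (A i)).
Context (uA : forall i, {ae mu, forall y, A i y \in unitmx}).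
Context (dkA : forall i, {ae mu, forall y, mn (A i y) * mn (invmx (A i y)) <= P ^+ nu}).
Local Notation w := (weight Phi A beta).

Lemma C3_weight : C3 mu Phi A alphas lams = (\int[mu]_y (w y)%:E)%E.
Proof. by []. Qed.

(** The distortion allowed by (DK1), times the norm of the output power over the norms of the input
    powers. *)
Definition lower_const := P `^ (nu%:R * \sum_(i < m) beta i) * wpow_norm mu q lam alpha /
  \prod_(i < m) wpow_norm mu (qs i) (lams i) (alphas i).

Lemma lower_const_gt0 : 0 < lower_const.
Proof.
apply: divr_gt0.
  by apply: mulr_gt0; [exact: powR_gt0|exact: (wpow_norm_gt0 hp hK n0 haar_mu q0 alpha_gt lam_gt)].
by apply: prodr_gt0 => i _; exact: (wpow_norm_gt0 hp hK n0 haar_mu).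
Qed.

Lemma Hbound_ge C : Hbound mu Phi A q lam alpha qs lams alphas C ->
  (lower_const%:E * C3 mu Phi A alphas lams <= C%:E)%E.
Proof.
move=> HC; pose fs i (z : V) := wpow abs (beta i) (z : 'cV[K]_n).
have Np i : 0 < wpow_norm mu (qs i) (lams i) (alphas i) by exact: (wpow_norm_gt0 hp hK n0 haar_mu).
have fsM i : in_morrey mu (qs i) (lams i) (alphas i) (fs i).
  exact: (wpow_in_morrey hp hK n0 haar_mu).
have := HC fs fsM.
under eq_bigr do rewrite (morrey_norm_wpow hp hK n0 haar_mu) //=.
have I0 : (0 <= \int[mu]_y (w y)%:E)%E.
  by apply: integral_ge0 => y _; rewrite lee_fin (weight_ge0 hK).
have k0 : (0 <= (P `^ (nu%:R * \sum_(i < m) beta i))%:E * (\int[mu]_y (w y)%:E))%E.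
  by rewrite mule_ge0 // lee_fin powR_ge0.
have mfs i : measurable_fun setT (fs i) by exact: (measurable_wpow hp hK).
have low := @morrey_norm_ge p R K abs hp hK n n0 mu haar_mu q lam alpha (Hop mu m Phi A fs) _
  q0 alpha_gt lam_gt k0 (measurable_Hop hp hK haar_mu mPhi mA mfs).
(* By the relation between [lam] and the [lams i], the extremal exponent of the target space is the
   sum of the [beta i]. *)
rewrite hlam in low => up.
have {}low := low (fun x x0 => Hop_wpow_ge hp hK n0 Phi0 mPhi mA uA dkA beta_le0 x0).
have := le_trans low up; rewrite EFinM -lee_pdivrMr; last by apply: prodr_gt0.
rewrite C3_weight /lower_const => h; apply: le_trans h.
by rewrite -[leRHS]muleA -EFinM [leRHS]muleAC -EFinM mulrA.
Qed.

Local Notation D i := (dilation_const mu nu (qs i) (lams i) (alphas i)).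
Local Notation theta i := (q / qs i).

(** What remains of the normalization by the mass of [B g] and of the levels once all powers of
    [p^g] have cancelled. *)
Definition upper_const := wmass mu alpha `^ ((- 1 - lam * q) * q^-1) *
  \prod_(i < m) D i `^ (qs i)^-1.

Lemma upper_const_gt0 : 0 < upper_const.
Proof.
apply: mulr_gt0; first by apply: powR_gt0; exact: (wmass_gt0 hp hK n0 haar_mu alpha_gt).
by apply: prodr_gt0 => i _; apply: powR_gt0; exact: (dilation_const_gt0 hp hK n0 haar_mu).
Qed.

Let theta_ge0 i : 0 <= theta i. Proof. by rewrite divr_ge0 // ltW. Qed.
Let theta_sum : \sum_(i < m) theta i = 1.
Proof. by rewrite -mulr_sumr hsumq divff // gt_eqF. Qed.

(** * The upper estimate on one ball for fixed functions *)

Section fixed_functions.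
Context (fs : 'I_m -> V -> R) (t : 'I_m -> R) (g : int).
Context (fsM : forall i, in_morrey mu (qs i) (lams i) (alphas i) (fs i)).
Context (t0 : forall i, 0 < t i).
Context (Nt : forall i, fine (morrey_norm mu (qs i) (lams i) (alphas i) (fun x => (fs i x)%:E))
    <= t i).

Let mfs i : measurable_fun setT (fs i). Proof. by case: (fsM i). Qed.

(** The bound of [integral_dilation_le] with the norm replaced by a positive majorant [t i], so that
    AM-GM may divide by it. *)
Definition level i := D i * t i `^ qs i * P `^ (g%:~R * ((alphas i + n%:R) * (1 + lams i * qs i))).

Lemma level_gt0 i : 0 < level i.
Proof.
apply: mulr_gt0; last exact: powR_gt0.
by apply: mulr_gt0; [exact: (dilation_const_gt0 hp hK n0 haar_mu)|exact: powR_gt0].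
Qed.

(** The power of [|A_i^-1|] makes the integral over a ball bounded independently of [y]; the
    opposite power is part of [weight]. *)
Definition factor i (x y : V) :=
  `|fs i (A i y *m (x : 'cV[K]_n))| * mn (invmx (A i y)) `^ beta i.

Definition normalized (x y : V) := \prod_(i < m) factor i x y.

Lemma factor_ge0 i x y : 0 <= factor i x y.
Proof. by rewrite mulr_ge0 ?powR_ge0. Qed.

Lemma normalized_ge0 x y : 0 <= normalized x y.
Proof. by apply: prodr_ge0 => i _; exact: factor_ge0. Qed.

Lemma measurable_factor i : measurable_fun setT (fun xy : V * V => factor i xy.1 xy.2).
Proof.
apply: measurable_funM.
  have h := measurableT_comp (mfs i) (measurable_action hp hK mA i).
  by apply: (measurableT_comp _ h); exact: normr_measurable.
exact: (measurableT_comp (measurable_mxinv_powR hp hK mA i (beta i)) measurable_snd).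
Qed.

Lemma measurable_normalized : measurable_fun setT (fun xy : V * V => normalized xy.1 xy.2).
Proof. by apply: measurable_prod => i _; exact: measurable_factor. Qed.

(* Hoelder's inequality, through AM-GM once every factor is normalized by its level. *)
Lemma normalized_powR_le (x y : V) : (x : 'cV[K]_n) != 0 ->
  normalized x y `^ q * wpow abs alpha (x : 'cV[K]_n) <=
  \sum_(i < m) (\prod_(j < m) level j `^ theta j) * theta i / level i *
    (factor i x y `^ qs i * wpow abs (alphas i) (x : 'cV[K]_n)).
Proof.
move=> x0; pose u i := factor i x y `^ qs i * wpow abs (alphas i) (x : 'cV[K]_n).
have u0 i : 0 <= u i by rewrite mulr_ge0 ?powR_ge0.
have uE : normalized x y `^ q * wpow abs alpha (x : 'cV[K]_n) = \prod_(i < m) u i `^ theta i.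
  have -> : alpha = \sum_(i < m) alphas i * theta i.
    under eq_bigr do rewrite mulrCA.
    by rewrite -mulr_sumr hsumalpha mulrCA divff ?mulr1 // gt_eqF.
  rewrite -(sum_wpow hK) // /normalized.
  rewrite powR_prod; last by move=> i; exact: factor_ge0.
  rewrite -big_split /=; apply: eq_bigr => i _.
  rewrite /u powRM ?powR_ge0 // -powRrM /wpow -powRrM; congr (_ `^ _ * _).
  by rewrite mulrCA divff ?mulr1 // gt_eqF.
rewrite uE.
exact: (weighted_AGM_scaled theta_ge0 theta_sum level_gt0 u0).
Qed.

Lemma integral_normalized_le y :
  (forall i, A i y \in unitmx /\ mn (A i y) * mn (invmx (A i y)) <= P ^+ nu) ->
  (\int[mu]_(x in B g) (normalized x y `^ q * wpow abs alpha (x : 'cV[K]_n))%:E <=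
    (\prod_(j < m) level j `^ theta j)%:E)%E.
Proof.
move=> good; set E := \prod_(j < m) _.
have E0 : 0 <= E by apply: prodr_ge0 => i _; exact: powR_ge0.
have mfac i : measurable_fun setT (fun x : V => factor i x y).
  exact: (measurableT_comp (measurable_factor i) (pair2_measurable y)).
have mu_i i : measurable_fun setT (fun x : V => factor i x y `^ qs i * wpow abs (alphas i) (x :
    'cV[K]_n)).
  apply: measurable_funM; last exact: (measurable_wpow hp hK).
  exact: (measurableT_comp (measurable_powR _) (mfac i)).
have c0 i : 0 <= E * theta i / level i by apply: divr_ge0; [exact: mulr_ge0|exact/ltW/level_gt0].
have cu0 i (x : V) : (0 <= (E * theta i / level i)%:E *
    (factor i x y `^ qs i * wpow abs (alphas i) (x : 'cV[K]_n))%:E)%E.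
  by apply: mule_ge0; rewrite lee_fin; [exact: c0|apply: mulr_ge0; exact: powR_ge0].
have mnorm_y : measurable_fun setT (fun x : V => normalized x y).
  exact: (measurableT_comp measurable_normalized (pair2_measurable y)).
apply: (@le_trans _ _ (\int[mu]_(x in B g) \sum_(i < m) (E * theta i / level i)%:E *
    (factor i x y `^ qs i * wpow abs (alphas i) (x : 'cV[K]_n))%:E)%E).
  apply: (le_integral_neq0 hp hK n0 haar_mu).
  - exact: measurable_Bball.
  - apply/measurable_EFinP; apply: measurable_funM; last exact: (measurable_wpow hp hK).
    exact: (measurableT_comp (measurable_powR _) mnorm_y).
  - apply: emeasurable_sum => i; apply: measurable_funeM.
    exact/measurable_EFinP.
  - by move=> x; rewrite lee_fin mulr_ge0 ?powR_ge0.
  - by move=> x; apply: sume_ge0 => i _; exact: cu0.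
  - move=> x _ x0; under eq_bigr do rewrite -EFinM.
    by rewrite sumEFin lee_fin; exact: normalized_powR_le.
rewrite ge0_integral_sum //; last 2 first.
- exact: measurable_Bball.
- move=> i; apply: measurable_funTS; apply: measurable_funeM.
  exact/measurable_EFinP.
apply: (@le_trans _ _ (\sum_(i < m) (E * theta i / level i)%:E * (level i)%:E)%E).
  apply: lee_sum => i _.
  rewrite ge0_integralZl ?lee_fin //; last 3 first.
  - exact: measurable_Bball.
  - by apply: measurable_funTS; exact/measurable_EFinP.
  - by move=> x _; rewrite lee_fin mulr_ge0 ?powR_ge0.
  rewrite lee_wpmul2l ?lee_fin //; have [u dk] := good i.
  apply: le_trans (integral_dilation_le hp hK n0 haar_mu g (qs0 i) (halphas i) (lams_gt i) (fsM
      i) u dk) _.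
  have D0 : 0 <= D i by apply/ltW; exact: (dilation_const_gt0 hp hK n0 haar_mu).
  rewrite lee_fin /level ler_wpM2r ?powR_ge0 // ler_wpM2l //.
  apply: ge0_ler_powR; rewrite ?(ltW (qs0 i)) ?nnegrE ?(ltW (t0 i)) //.
  by rewrite fine_ge0 // morrey_norm_ge0.
(* Each level cancels against its own integral bound, leaving [E] times the sum of the [theta i],
   which is 1. *)
under eq_bigr do rewrite -EFinM divfK ?gt_eqF ?level_gt0 //.
by rewrite sumEFin -mulr_sumr theta_sum mulr1.
Qed.

Lemma Hop_abs_le (x : V) :
  (`|Hop mu m Phi A fs x| <= \int[mu]_y (w y * normalized x y)%:E)%E.
Proof.
have mF : measurable_fun setT (fun y : V => ((Phi y / (vn (y : 'cV[K]_n) ^+ n)) *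
     \prod_(i < m) fs i (A i y *m (x : 'cV[K]_n)))%:E).
  apply/measurable_EFinP.
  exact: (measurableT_comp (measurable_Hop_integrand hp hK mPhi mA mfs) (pair1_measurable x)).
apply: (le_trans (le_abse_integral mu measurableT mF)).
apply: ae_ge0_le_integral => //.
- exact: measurableT_comp.
- by move=> y _; rewrite lee_fin mulr_ge0 ?normalized_ge0 // (weight_ge0 hK).
- apply/measurable_EFinP; apply: measurable_funM; first exact: (measurable_weight hp hK mPhi mA).
  exact: (measurableT_comp measurable_normalized (pair1_measurable x)).
apply: filterS (ae_unitmx_DK1 uA dkA) => y good _; rewrite lee_fin normrM normr_prod.
rewrite (ger0_norm (kernel_ge0 hK Phi0 y)) /weight /normalized -mulrA ler_wpM2l ?(kernel_ge0 hK) //.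
rewrite -big_split /= le_eqVlt; apply/orP; left; apply/eqP; apply: eq_bigr => i _.
have [u _] := good i; have b0 := mnorm_invmx_gt0 hK n0 u.
by rewrite /factor mulrCA powRN mulVf ?mulr1 // gt_eqF // powR_gt0.
Qed.

Lemma Hop_ball_le (M : R) : 0 < M -> (\int[mu]_y (w y)%:E <= M%:E)%E ->
  (\int[mu]_(x in B g) (`|Hop mu m Phi A fs x| `^ q * (wpow abs alpha (x : 'cV[K]_n))%:E) <=
   (M `^ q * \prod_(j < m) level j `^ theta j)%:E)%E.
Proof.
move=> M0 wM; set E := \prod_(j < m) _.
have E0 : 0 <= E by apply: prodr_ge0 => i _; exact: powR_ge0.
have mw : measurable_fun setT w by exact: (measurable_weight hp hK mPhi mA).
have w0 y : 0 <= w y by exact: (weight_ge0 hK).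
have mH := measurable_Hop hp hK haar_mu mPhi mA mfs.
have mnq : measurable_fun setT (fun xy : V * V => normalized xy.1 xy.2 `^ q).
  exact: (measurableT_comp (measurable_powR _) measurable_normalized).
pose F (x y : V) := w y * (normalized x y `^ q * wpow abs alpha (x : 'cV[K]_n)).
have F0 x y : 0 <= F x y.
  by apply: mulr_ge0 => //; apply: mulr_ge0; exact: powR_ge0.
have mF : measurable_fun setT (fun xy : V * V => F xy.1 xy.2).
  apply: measurable_funM; first exact: (measurableT_comp mw measurable_snd).
  apply: measurable_funM => //.
  exact: (measurableT_comp (measurable_wpow hp hK alpha) measurable_fst).
(* The restriction to [B g] is moved into the integrand, so that Tonelli applies on the full product
   space. *)
pose F1 (xy : V * V) : \bar R := (F xy.1 xy.2 * \1_(B g) xy.1)%:E.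
have mF1 : measurable_fun setT F1.
  apply/measurable_EFinP; apply: measurable_funM => //.
  have h : measurable_fun setT (\1_(B g) : V -> R) by apply: measurable_indic; exact:
      measurable_Bball.
  exact: (measurableT_comp h measurable_fst).
have F10 xy : (0 <= F1 xy)%E by rewrite lee_fin mulr_ge0.
have mFy : measurable_fun setT (fun x : V => (\int[mu]_y (F x y)%:E)%E).
  apply: (haar_tonelli_measurable hp hK haar_mu (f := fun xy : V * V => (F xy.1 xy.2)%:E)).
    exact/measurable_EFinP.
  by move=> xy; rewrite lee_fin.
have Mq0 : 0 <= M `^ (q - 1) by exact: powR_ge0.
apply: (@le_trans _ _ (\int[mu]_(x in B g) ((M `^ (q - 1))%:E * \int[mu]_y (F x y)%:E))%E).
  apply: ge0_le_integral.
  - exact: measurable_Bball.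
  - by move=> x _; rewrite mule_ge0 ?poweR_ge0 // lee_fin powR_ge0.
  - apply: measurable_funTS; apply: emeasurable_funM; last exact: (measurable_wpowE hp hK).
    apply: (measurableT_comp (measurable_poweR q)).
    exact: measurableT_comp.
  - by apply: measurable_funTS; apply: measurable_funeM.
  move=> x _.
  have nx : measurable_fun setT (fun y => normalized x y).
    exact: (measurableT_comp measurable_normalized (pair1_measurable x)).
  have wn0 : (0 <= \int[mu]_y (w y * normalized x y)%:E)%E.
    by apply: integral_ge0 => y _; rewrite lee_fin mulr_ge0 // normalized_ge0.
  have h1 : (`|Hop mu m Phi A fs x| `^ q <= (\int[mu]_y (w y * normalized x y)%:E) `^ q)%E.
    apply: gt0_ler_poweR; rewrite ?(ltW q0) //; last exact: Hop_abs_le.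
      by rewrite in_itv /= leey andbT abse_ge0.
    by rewrite in_itv /= leey andbT.
  have h2 := jensen_integral q1 M0 mw nx w0 (normalized_ge0 x) wM.
  have -> : (\int[mu]_y (F x y)%:E = (\int[mu]_y (w y * normalized x y `^ q)%:E) *
      (wpow abs alpha (x : 'cV[K]_n))%:E)%E.
    have e : (\int[mu]_y ((wpow abs alpha (x : 'cV[K]_n))%:E * (w y * normalized x y `^ q)%:E) =
        (wpow abs alpha (x : 'cV[K]_n))%:E * \int[mu]_y (w y * normalized x y `^ q)%:E)%E.
      apply: ge0_integralZl; first exact: measurableT.
      - apply/measurable_EFinP; apply: measurable_funM => //.
        exact: (measurableT_comp (measurable_powR _) nx).
      - by move=> y _; rewrite lee_fin; apply: mulr_ge0 => //; exact: powR_ge0.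
      - by rewrite lee_fin wpow_ge0.
    rewrite [RHS]muleC -e; apply: eq_integral => y _.
    by rewrite -EFinM /F mulrA mulrC.
  rewrite muleA; apply: lee_wpmul2r; first by rewrite lee_fin wpow_ge0.
  exact: le_trans h1 h2.
(* Jensen accounts for [M^(q-1)]; the remaining [M] bounds the mass of [w] after the integral over
   [x] has been estimated for each [y]. *)
have -> : M `^ q = M `^ (q - 1) * M.
  by rewrite mulrC mulr_powRB1 // ltW.
rewrite ge0_integralZl ?lee_fin //; last 3 first.
- exact: measurable_Bball.
- exact: measurable_funTS.
- by move=> x _; apply: integral_ge0 => y _; rewrite lee_fin.
rewrite -mulrA EFinM lee_wpmul2l ?lee_fin //.
have -> : (\int[mu]_(x in B g) \int[mu]_y (F x y)%:E = \int[mu]_x \int[mu]_y F1 (x, y))%E.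
  rewrite integral_mkcond; apply: eq_integral => x _; rewrite patchE; case: ifPn => xB.
    by apply: eq_integral => y _; rewrite /F1 /= indicE xB mulr1.
  rewrite (eq_integral (fun=> 0%E)) ?integral0 // => y _.
  by rewrite /F1 /= indicE (negbTE xB) mulr0.
rewrite (haar_tonelli hp hK haar_mu mF1 F10).
apply: (@le_trans _ _ (\int[mu]_y (E%:E * (w y)%:E))%E); last first.
  rewrite ge0_integralZl ?lee_fin //; last 2 first.
  - exact/measurable_EFinP.
  - by move=> y _; rewrite lee_fin.
  by rewrite EFinM muleC lee_wpmul2r ?lee_fin.
have mF1y (y : V) : measurable_fun setT (fun x => F1 (x, y)).
  exact: (measurableT_comp mF1 (pair2_measurable y)).
apply: ae_ge0_le_integral => //.
- by move=> y _; apply: integral_ge0.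
- apply: (haar_tonelli_measurable hp hK haar_mu (f := fun yx : V * V => F1 (yx.2, yx.1))) => //.
  exact: (measurableT_comp mF1 (measurable_fun_pair measurable_snd measurable_fst)).
- by move=> y _; rewrite mule_ge0 ?lee_fin.
- by apply: measurable_funeM; exact/measurable_EFinP.
apply: filterS (ae_unitmx_DK1 uA dkA) => y good _.
have -> : (\int[mu]_x F1 (x, y) = (w y)%:E *
    \int[mu]_(x in B g) (normalized x y `^ q * wpow abs alpha (x : 'cV[K]_n))%:E)%E.
  rewrite -ge0_integralZl ?lee_fin //; last 3 first.
  - exact: measurable_Bball.
  - apply: measurable_funTS; apply/measurable_EFinP; apply: measurable_funM; last exact:
      (measurable_wpow hp hK).
    exact: (measurableT_comp mnq (pair2_measurable y)).
  - by move=> x _; rewrite lee_fin; apply: mulr_ge0; exact: powR_ge0.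
  rewrite [RHS]integral_mkcond; apply: eq_integral => x _; rewrite patchE /F1 /= indicE.
  by case: ifP => _; rewrite ?mulr1 ?mulr0.
rewrite muleC lee_wpmul2r ?lee_fin //.
exact: integral_normalized_le.
Qed.

(** The [q]-th root isolates the majorants [t i] to the first power and gathers the powers of [p^g]
    into the exponent by which the mass of [B g] grows. *)
Lemma level_root :
  (\prod_(j < m) level j `^ theta j) `^ q^-1 =
  (\prod_(i < m) D i `^ (qs i)^-1) * (\prod_(i < m) t i) *
    P `^ (g%:~R * ((alpha + n%:R) * (1 + lam * q) * q^-1)).
Proof.
have D0 i : 0 < D i by exact: (dilation_const_gt0 hp hK n0 haar_mu).
have lE j : (level j `^ theta j) `^ q^-1 = D j `^ (qs j)^-1 * t j *
    P `^ (g%:~R * ((alphas j + n%:R) / qs j + (alphas j + n%:R) * lams j)).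
  have -> : (level j `^ theta j) `^ q^-1 = level j `^ (qs j)^-1.
    by rewrite -powRrM mulrAC mulfV ?mul1r // gt_eqF.
  rewrite /level powRM ?powR_ge0 //; last by apply: mulr_ge0; [exact/ltW/D0|exact: powR_ge0].
  rewrite powRM ?powR_ge0 //; last exact/ltW/D0.
  rewrite -!(powRrM _ _ (qs j)^-1) mulfV ?gt_eqF // powRr1 ?(ltW (t0 j)) //.
  congr (_ * _ * _ `^ _); field.
  by rewrite gt_eqF.
rewrite powR_prod; last by move=> j; exact: powR_ge0.
rewrite (eq_bigr _ (fun j _ => lE j)) !big_split /=; congr (_ * _).
have -> : (alpha + n%:R) * (1 + lam * q) * q^-1 =
    \sum_(j < m) ((alphas j + n%:R) / qs j + (alphas j + n%:R) * lams j).
  rewrite big_split /= sum_alpha_shift -hlam; field.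
  by rewrite gt_eqF.
rewrite mulr_sumr; elim/big_rec2: _ => [|i u v _ ->]; first by rewrite powRr0.
by rewrite powRD //; apply/implyP => _; rewrite gt_eqF.
Qed.

Lemma Hop_term_le (M : R) : 0 < M -> (\int[mu]_y (w y)%:E <= M%:E)%E ->
  ((((fine (wball mu alpha g)) `^ (- 1 - lam * q))%:E *
    \int[mu]_(x in B g) (`|Hop mu m Phi A fs x| `^ q * (wpow abs alpha (x : 'cV[K]_n))%:E)) `^ q^-1
   <= (upper_const * M * \prod_(i < m) t i)%:E)%E.
Proof.
move=> M0 wM; have hb := Hop_ball_le M0 wM.
set E := \prod_(j < m) _ in hb.
have E0 : 0 <= E by apply: prodr_ge0 => i _; exact: powR_ge0.
set I := (\int[mu]_(x in B g) _)%E in hb *.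
have I0 : (0 <= I)%E.
  by apply: integral_ge0 => x _; rewrite mule_ge0 ?poweR_ge0 // lee_fin wpow_ge0.
set v := fine (wball mu alpha g).
apply: (@le_trans _ _ (((v `^ (- 1 - lam * q))%:E * (M `^ q * E)%:E) `^ q^-1)%E).
  apply: gt0_ler_poweR; first by rewrite invr_ge0 ltW.
  - by rewrite in_itv /= leey andbT mule_ge0 // lee_fin powR_ge0.
  - by rewrite in_itv /= leey andbT mule_ge0 // lee_fin ?mulr_ge0 ?powR_ge0.
  by rewrite lee_wpmul2l // lee_fin powR_ge0.
rewrite -EFinM poweR_EFin lee_fin le_eqVlt; apply/orP; left; apply/eqP.
rewrite powRM ?powR_ge0 //; last by rewrite mulr_ge0 ?powR_ge0.
rewrite (powRM _ (powR_ge0 _ _) E0) -!(powRrM _ _ q^-1) mulfV ?gt_eqF // (powRr1 (ltW M0)).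
rewrite /v (wball_powR hp hK n0 haar_mu _ _ alpha_gt) /E level_root /upper_const.
set X := P `^ _; set Y := P `^ _.
(* The powers of [p^g] from the normalization and from the levels are inverse to each other, so the
   bound is the same for every ball. *)
have XY : X * Y = 1.
  rewrite /X /Y -powRD; last by apply/implyP => _; rewrite gt_eqF.
  by rewrite (_ : _ + _ = 0) ?powRr0 //; ring.
set W := wmass _ _ `^ _; set a := \prod_(i < m) D i `^ _; set b := \prod_(i < m) t i.
transitivity ((X * Y) * (W * a * M * b)); first by ring.
by rewrite XY mul1r.
Qed.

End fixed_functions.

(* A norm may vanish, while the levels have to be positive: the bound is proved for
   [N i + e] and [c + e], and [e] tends to 0. *)
Lemma Hbound_upper (c : R) : 0 <= c -> C3 mu Phi A alphas lams = c%:E ->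
  Hbound mu Phi A q lam alpha qs lams alphas (upper_const * c).
Proof.
move=> c0; rewrite C3_weight => cE fs fsM; apply: le_prod_shift => e e0.
pose N i := fine (morrey_norm mu (qs i) (lams i) (alphas i) (fun x => (fs i x)%:E)).
have N0 i : 0 <= N i by apply: fine_ge0; exact: morrey_norm_ge0.
apply: ge_ereal_sup => _ [g _ <-].
apply: (Hop_term_le (t := fun i => N i + e)) => //.
- by move=> i; rewrite ltr_wpDl.
- by move=> i; rewrite lerDl ltW.
- by rewrite ltr_wpDl.
- by rewrite cE lee_fin lerDl ltW.
Qed.

End fixed_kernel.
End bounds.

(** * Boundedness criterion and two-sided norm estimate *)

Theorem theorem3p3
  (p : nat) (hp : prime p)
  (R : realType) (K : fieldType) (abs : K -> R) (hK : is_Qp_model p abs)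
  (n : nat) (hn : (0 < n)%N)
  (mu : {measure set (Qpn abs p n) -> \bar R}) (hmu : is_haar abs mu)
  (m : nat) (hm : (0 < m)%N)
  (q : R) (qs : 'I_m -> R) (alpha : R) (alphas : 'I_m -> R)
  (lam : R) (lams : 'I_m -> R) (nu : nat)
  (hq : 1 <= q) (hqs : forall i, 1 <= qs i)
  (halphas : forall i, - (n%:R) < alphas i)
  (hsumq : \sum_(i < m) (qs i)^-1 = q^-1)
  (hsumalpha : \sum_(i < m) alphas i / qs i = alpha / q)
  (hlams : forall i, - (qs i)^-1 < lams i < 0)
  (hlam : (alpha + n%:R) * lam = \sum_(i < m) (alphas i + n%:R) * lams i) :
  exists c1 c2 : R, 0 < c1 /\ 0 < c2 /\
  forall (Phi : Qpn abs p n -> R) (A : 'I_m -> Qpn abs p n -> 'M[K]_n),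
    (forall y, 0 <= Phi y) ->
    measurable_fun setT Phi ->
    (forall i, meas_mx abs (A i)) ->
    (forall i, {ae mu, forall y, A i y \in unitmx}) ->
    (* condition (DK1) *)
    (forall i, {ae mu, forall y,
        mnorm abs (A i y) * mnorm abs (invmx (A i y)) <= (p%:R : R) ^+ nu}) ->
    (Hbounded mu Phi A q lam alpha qs lams alphas <->
       (C3 mu Phi A alphas lams < +oo)%E) /\
    (c1%:E * C3 mu Phi A alphas lams
       <= Hopnorm mu Phi A q lam alpha qs lams alphas
       <= c2%:E * C3 mu Phi A alphas lams)%E.
Proof.
exists (lower_const mu q qs alpha alphas lam lams nu).
exists (upper_const mu q qs alpha alphas lam lams nu).
have c10 : 0 < lower_const mu q qs alpha alphas lam lams nu.
  exact: (lower_const_gt0 hp hK hn hmu hm).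
have c20 : 0 < upper_const mu q qs alpha alphas lam lams nu.
  exact: (upper_const_gt0 hp hK hn hmu hm).
split=> //; split=> // Phi A Phi0 mPhi mA uA dkA.
set C := C3 mu Phi A alphas lams.
have C0 : (0 <= C)%E.
  by apply: integral_ge0 => y _; rewrite lee_fin (weight_ge0 hK).
have low c : Hbound mu Phi A q lam alpha qs lams alphas c ->
    ((lower_const mu q qs alpha alphas lam lams nu)%:E * C <= c%:E)%E.
  exact: (Hbound_ge hp hK hn hmu hm).
have up : (C < +oo)%E -> Hbound mu Phi A q lam alpha qs lams alphas
    (upper_const mu q qs alpha alphas lam lams nu * fine C).
  move=> Coo; apply: (Hbound_upper hp hK hn hmu hm) => //; first exact: fine_ge0.
  by rewrite fineK // ge0_fin_numE.
split.
  split=> [[c /low h]|/up h]; last by eexists; exact: h.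
  (* If [C] were infinite, a positive multiple of it would lie below the real number [c]. *)
  rewrite ltey; apply/eqP => Coo; move: h.
  by rewrite Coo gt0_muley ?lte_fin // leNgt ltry.
apply/andP; split.
  by apply: le_ereal_inf_tmp => _ [c [_ hc] <-]; exact: low.
have [Coo|] := boolP (C < +oo)%E; last first.
  by rewrite ltey negbK => /eqP ->; rewrite gt0_muley ?lte_fin // leey.
rewrite -[X in (_ <= _ * X)%E]fineK ?ge0_fin_numE // -EFinM.
apply: ereal_inf_lbound.
exists (upper_const mu q qs alpha alphas lam lams nu * fine C) => //; split; last exact: up.
by rewrite mulr_ge0 ?fine_ge0 // ltW.
Qed.
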